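(* Let $V=\mathbb{R}^n$, let $(\Omega,\mathcal{F},P)$ be a complete probability space with automorphism $T$ and filtration $(\mathcal{F}_t)_{t\in\mathbb{Z}}$ as in the context, let $\omega\mapsto K(\omega)\subseteq V$ be an $\mathcal{F}_0$-measurable mapping whose values are solid cones, and for each $\omega\in\Omega$ let $D(\omega)=D(\omega,\cdot)$ be a mapping of $K(\omega)$ into $K(T\omega)$. Let $\phi(\omega)$ be a fixed $\mathcal{F}_0$-measurable linear functional such that $\phi(\omega)$ belongs to the interior of the dual cone $K^{*}(\omega)$ for each $\omega$. Assume: 1. $D(\omega,x)$ is continuous in $x\in K(\omega)$, and the extended mapping $\bar D(\omega,x)$ is $\mathcal{F}_1\times\mathcal{V}$-measurable in $(\omega,x)\in\Omega\times V$. 2. $D(\omega,\lambda x)=\lambda D(\omega,x)$ for any $\lambda>0$ and $x\in K(\omega)$. 3. $D(\omega,\cdot)$ is a completely monotone mapping from $K(\omega)$ into $K(T\omega)$. 4. For almost all $\omega\in\Omega$ there is a natural number $l_\omega$ such that the mapping $C(l_\omega,\omega):K(\omega)\to K(T^{l_\omega}\omega)$ is strictly monotone. Then the following hold. (a) There exist an $\mathcal{F}_0$-measurable vector function $x(\omega)$ and an $\mathcal{F}_1$-measurable scalar function $\alpha(\omega)$ such that $$\alpha(\omega)>0,\quad x(\omega)\in K^{\circ}(\omega),\quad \langle\phi(\omega),x(\omega)\rangle=1$$ for all $\omega$, and $$\alpha(\omega)\,x(T\omega)=D(\omega)x(\omega)\quad\text{(a.s.)}.\qquad( * )$$ (b)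 The pair of functions $(\alpha(\omega),x(\omega))$, where $\alpha(\omega)\ge 0$, $x(\omega)\in K(\omega)$ and $\langle\phi(\omega),x(\omega)\rangle=1$, satisfying $( * )$ is determined uniquely up to equivalence with respect to the measure $P$ (i.e. any two such pairs coincide almost surely). (c) If $t\to\infty$, then $$\left\Vert\frac{C(t,T^{-t}\omega)a}{\langle\phi(\omega),C(t,T^{-t}\omega)a\rangle}-x(\omega)\right\Vert\to 0\quad\text{(a.s.)},$$ where convergence is uniform in $0\neq a\in K(T^{-t}\omega)$ (i.e. for almost every $\omega$ the supremum of the left-hand side over $0\ne a\in K(T^{-t}\omega)$ tends to $0$ as $t\to\infty$).
   Context: Cones. $V=\mathbb{R}^n$ is a finite-dimensional real vector space with some norm $\Vert\cdot\Vert$, and $\mathcal{V}$ is its Borel $\sigma$-algebra. A subset $K\subseteq V$ is a cone if it contains with any vectors $x,y$ every non-negative linear combination $\alpha x+\beta y$. It is proper if $K\cap(-K)=\{0\}$. A solid cone is a closed proper cone with non-empty interior $K^{\circ}$. For a solid cone $K$: $x\le_K y$ means $y-x\in K$; $x\prec_K y$ means $x\le_K y$ and $x\ne y$; $x<_K y$ means $y-x\in K^{\circ}$. The dual cone is $K^{*}=\{\phi\in V^{*}:\phi(x)\ge 0\text{ for all }x\in K\}$, where $V^*$ is the dual space; $\langle\phi,x\rangle=\phi(x)$. Monotonicity. For solid cones $K,L\subseteq V$, a mapping $D:K\to L$ is completely monotone if for all $x,y\in K$ each of the relations $x\le_K y$, $x\prec_K y$, $x<_K y$ implies the corresponding relation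 $D(x)\le_L D(y)$, $D(x)\prec_L D(y)$, $D(x)<_L D(y)$. It is strictly monotone if $x\prec_K y$ implies $D(x)<_L D(y)$. Probabilistic setting. $(\Omega,\mathcal{F},P)$ is a complete probability space and $T:\Omega\to\Omega$ is an automorphism: a one-to-one (bijective) mapping such that $T$ and $T^{-1}$ are measurable and preserve $P$. $\dots\subseteq\mathcal{F}_{-1}\subseteq\mathcal{F}_0\subseteq\mathcal{F}_1\subseteq\dots$ is a filtration of sub-$\sigma$-algebras of $\mathcal{F}$, each containing all $\mathcal{F}$-measurable sets of measure $0$, and invariant with respect to $T$: $\mathcal{F}_{t+1}=T^{-1}\mathcal{F}_t$ for each $t$. A set-valued mapping $\omega\mapsto K(\omega)\subseteq V$ is $\mathcal{F}_0$-measurable if its graph $\{(\omega,x):x\in K(\omega)\}$ belongs to $\mathcal{F}_0\times\mathcal{V}$ (product $\sigma$-algebra). $K^{\circ}(\omega)$ and $K^*(\omega)$ denote the interior and the dual of $K(\omega)$. Extension and cocycle. $\bar D(\omega,x)=D(\omega,x)$ if $x\in K(\omega)$ and $\bar D(\omega,x)=\infty$ if $x\notin K(\omega)$, where $\infty$ is the added point of the one-point compactification of $V$. Put $D_t(\omega)=D(T^{t-1}\omega)$ and $$C(t,\omega)=D_t(\omega)D_{t-1}(\omega)\cdots D_1(\omega),\quad t=1,2,\dots,$$ where the product means composition of maps, and $C(0,\omega)=\mathrm{Id}$. Thus $C(t,\omega)$ maps $K(\omega)$ into $K(T^t\omega)$, and $C(t,T^{-t}\omega)$ maps $K(T^{-t}\omega)$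 into $K(\omega)$. *)

(* Defs.v *)
From HB Require Import structures.
From mathcomp Require Export all_boot all_order all_algebra.
From mathcomp Require Export all_classical all_reals all_analysis.
Export Order.TTheory GRing.Theory Num.Theory.
Export numFieldNormedType.Exports.

Set Implicit Arguments.
Unset Strict Implicit.
Unset Printing Implicit Defensive.

#[global] Open Scope classical_set_scope.
#[global] Open Scope ring_scope.

(* The space R^n is 'rV[R]_n with its canonical topology, which is the topology
   of every norm.  Its dual is 'cV[R]_n, acting through [pairing]. *)

Definition is_norm (R : realType) (n : nat) (N : 'rV[R]_n -> R) : Prop :=
  [/\ forall x y, N (x + y) <= N x + N y,
      forall (a : R) x, N (a *: x) = `|a| * N x
    & forall x, N x = 0 -> x = 0].

Definition pairing (R : realType) (n : nat) (phi : 'cV[R]_n) (x : 'rV[R]_n) : R :=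
  (x *m phi) 0 0.

Definition cone (R : realType) (n : nat) (K : set 'rV[R]_n) : Prop :=
  forall x y (a b : R), K x -> K y -> 0 <= a -> 0 <= b -> K (a *: x + b *: y).

Definition proper_cone (R : realType) (n : nat) (K : set 'rV[R]_n) : Prop :=
  cone K /\ K `&` [set x | K (- x)] = [set 0].

Definition solid_cone (R : realType) (n : nat) (K : set 'rV[R]_n) : Prop :=
  [/\ proper_cone K, closed K & interior K !=set0].

Definition dual_cone (R : realType) (n : nat) (K : set 'rV[R]_n) : set 'cV[R]_n :=
  [set phi | forall x, K x -> 0 <= pairing phi x].

Definition cone_le (R : realType) (n : nat) (K : set 'rV[R]_n) (x y : 'rV[R]_n) :=
  K (y - x).

Definition cone_prec (R : realType) (n : nat) (K : set 'rV[R]_n) (x y : 'rV[R]_n) :=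
  cone_le K x y /\ x <> y.

Definition cone_lt (R : realType) (n : nat) (K : set 'rV[R]_n) (x y : 'rV[R]_n) :=
  interior K (y - x).

(* A map from K to L is a total function of which only the values on K matter. *)
Definition completely_monotone (R : realType) (n : nat) (K L : set 'rV[R]_n)
    (D : 'rV[R]_n -> 'rV[R]_n) : Prop :=
  forall x y, K x -> K y ->
    [/\ cone_le K x y -> cone_le L (D x) (D y),
        cone_prec K x y -> cone_prec L (D x) (D y)
      & cone_lt K x y -> cone_lt L (D x) (D y)].

Definition strictly_monotone (R : realType) (n : nat) (K L : set 'rV[R]_n)
    (D : 'rV[R]_n -> 'rV[R]_n) : Prop :=
  forall x y, K x -> K y -> cone_prec K x y -> cone_lt L (D x) (D y).

(* Sub-sigma-algebras are sets of sets, since several of them live on the same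
   probability space. *)

Definition borel_sets (X : topologicalType) : set (set X) := <<s [set U | open U] >>.
Arguments borel_sets : clear implicits.

Definition prod_sigma_algebra (X Y : Type) (G : set (set X)) (H : set (set Y)) :
    set (set (X * Y)) :=
  <<s [set S | exists A B, [/\ G A, H B & S = A `*` B]] >>.

Definition borel_measurable (X : Type) (G : set (set X)) (Y : topologicalType)
    (f : X -> Y) : Prop :=
  forall B, borel_sets Y B -> G (f @^-1` B).

Definition preserves_measure (d : measure_display) (Omega : measurableType d)
    (R : realType) (P : probability Omega R) (T : Omega -> Omega) : Prop :=
  measurable_fun setT T /\ forall A, measurable A -> P (T @^-1` A) = P A.

(* S is the inverse of T. *)
Definition automorphism (d : measure_display) (Omega : measurableType d)
    (R : realType) (P : probability Omega R) (T S : Omega -> Omega) : Prop :=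
  [/\ cancel T S, cancel S T, preserves_measure P T & preserves_measure P S].

Definition invariant_filtration (d : measure_display) (Omega : measurableType d)
    (R : realType) (P : probability Omega R) (T : Omega -> Omega)
    (F : int -> set (set Omega)) : Prop :=
  [/\ forall t, sigma_algebra setT (F t) /\ F t `<=` measurable,
      forall t, F t `<=` F (t + 1),
      forall t A, measurable A -> P A = 0%E -> F t A
    & forall t, F (t + 1) = preimage_set_system setT T (F t)].

Definition graph_measurable (Omega : Type) (G : set (set Omega)) (R : realType)
    (n : nat) (K : Omega -> set 'rV[R]_n) : Prop :=
  prod_sigma_algebra G (borel_sets 'rV[R]_n) [set wx | K wx.1 wx.2].

Definition extension (Omega : Type) (R : realType) (n : nat)
    (K : Omega -> set 'rV[R]_n) (D : Omega -> 'rV[R]_n -> 'rV[R]_n)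
    (wx : Omega * 'rV[R]_n) : one_point_compactification 'rV[R]_n :=
  if wx.2 \in K wx.1 then Some (D wx.1 wx.2) else None.

Fixpoint cocycle (Omega : Type) (T : Omega -> Omega) (R : realType) (n : nat)
    (D : Omega -> 'rV[R]_n -> 'rV[R]_n) (t : nat) (w : Omega) (x : 'rV[R]_n) :
    'rV[R]_n :=
  if t is s.+1 then D (iter s T w) (cocycle T D s w x) else x.

(* Main.v *)
Require Import Defs.
From mathcomp Require Import ring lra.

(* Measure the closeness of two points of a cone by the largest [c] such that
   [x >= s y >= c x] for some [s], that is, by exp(-d) for the Hilbert metric d.
   Monotone homogeneous maps do not decrease it, so the worst closeness r_t(w) of
   two points of the image of C(t, T^-t w) is nondecreasing in t, and its limit
   satisfies r(w) <= r(T w).  Since T preserves P, in fact r(T w) = r(w) almost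
   surely.  Once a strictly monotone C(l, w) has mapped the cone, up to scaling,
   onto a compact set in the interior, the next strictly monotone iterate increases
   closeness by a uniform amount as long as r < 1; by invariance of r this is
   impossible, hence r = 1 almost surely.  Therefore the normalized images shrink to
   a point x(w), uniformly, and uniqueness and the equation for x(w) follow.

   Measurability needs no selection theorem: a solid cone is the closure of its
   rational points, so r is computed from countably many measurable functions. *)

Set Implicit Arguments.
Unset Strict Implicit.
Unset Printing Implicit Defensive.

(** * Cones and the Hilbert metric *)

Section NormedModule.
Context (R : realType) (V : normedModType R).

Lemma cvg_subZ (I : Type) (F : set_system I) (FF : Filter F) (f g : I -> V)
    (s : I -> R) (x y : V) (a : R) :
  f @ F --> x -> s @ F --> a -> g @ F --> y ->
  f i - s i *: g i @[i --> F] --> x - a *: y.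
Proof. by move=> fx sa gy; apply: cvgB => //; apply: cvgZ. Qed.

Lemma subr_cst_continuous (y : V) : continuous (fun z : V => z - y).
Proof. by move=> z; apply: cvgB; [exact: cvg_id|exact: cvg_cst]. Qed.

Lemma scalel_continuous (a : R) : continuous (fun z : V => a *: z).
Proof. by move=> z; apply: cvgZl_tmp; exact: cvg_id. Qed.

Lemma addZ_cvg0 (u v : V) : u + a *: v @[a --> 0^'+] --> u.
Proof.
apply: cvg_at_right_filter; rewrite -[X in _ --> X]addr0 -(scale0r v).
by apply: cvgD; [exact: cvg_cst|apply: cvgZr_tmp; exact: cvg_id].
Qed.

Lemma nbhs_subr (A : set V) (x y : V) : nbhs x A -> nbhs (x + y) [set z | A (z - y)].
Proof.
move=> Ax; have := @subr_cst_continuous y (x + y).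
by rewrite /continuous_at addrK; exact.
Qed.

Lemma nbhs_scaler (A : set V) (a : R) (x : V) : a != 0 ->
  nbhs x A -> nbhs (a *: x) (fun z => A (a^-1 *: z)).
Proof.
move=> a0 Ax; have := @scalel_continuous a^-1 (a *: x).
by rewrite /continuous_at scalerA mulVf// scale1r; exact.
Qed.

Lemma nbhs_addZ (A : set V) (u v : V) : nbhs u A -> \forall a \near 0^'+, A (u + a *: v).
Proof. by move=> Au; exact: (addZ_cvg0 v). Qed.

End NormedModule.

(** * Solid cones, their dual functionals and norms *)

Section ConeTheory.
Context (R : realType) (n : nat).
Implicit Types (K L : set 'rV[R]_n) (x y z : 'rV[R]_n) (phi : 'cV[R]_n).

Lemma pairingE phi x : pairing phi x = \sum_j x 0 j * phi j 0.
Proof. by rewrite /pairing mxE. Qed.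

Lemma pairingD phi x y : pairing phi (x + y) = pairing phi x + pairing phi y.
Proof. by rewrite /pairing mulmxDl mxE. Qed.

Lemma pairingZ phi (a : R) x : pairing phi (a *: x) = a * pairing phi x.
Proof. by rewrite /pairing -scalemxAl mxE. Qed.

Lemma pairingB phi x y : pairing phi (x - y) = pairing phi x - pairing phi y.
Proof. by rewrite pairingD -scaleN1r pairingZ mulN1r. Qed.

Lemma pairing0 phi : pairing phi 0 = 0.
Proof. by rewrite -(scale0r 0) pairingZ mul0r. Qed.

Lemma cvg_pairing (I : Type) (F : set_system I) (FF : Filter F)
    (f : I -> 'cV[R]_n) (g : I -> 'rV[R]_n) phi x :
  f @ F --> phi -> g @ F --> x -> pairing (f i) (g i) @[i --> F] --> pairing phi x.
Proof.
move=> fphi gx; rewrite pairingE; under eq_fun do rewrite pairingE.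
apply: cvg_big => [|j _]; first exact: add_continuous.
apply: cvgM.
  apply: (@continuous_cvg _ _ _ F FF g (fun M => M 0 j) x) gx.
  exact: coord_continuous.
apply: (@continuous_cvg _ _ _ F FF f (fun M => M j 0) phi) fphi.
exact: coord_continuous.
Qed.

Lemma pairing_continuous phi : continuous (pairing phi).
Proof. move=> x; apply: (@cvg_pairing _ (nbhs x) _ (fun=> phi) id phi x).
  exact: (@cvg_cst _ phi).
exact: (@cvg_id _ (nbhs x)). Qed.

Lemma coneD K x y : cone K -> K x -> K y -> K (x + y).
Proof. by move=> /(_ x y 1 1) cK Kx Ky; rewrite -(scale1r x) -(scale1r y); exact: cK. Qed.

Lemma coneZ K (a : R) x : cone K -> 0 <= a -> K x -> K (a *: x).
Proof.
move=> /(_ x x a 0) cK a0 Kx; have := cK Kx Kx a0 (lexx 0).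
by rewrite scale0r addr0.
Qed.

Lemma cone0 K x : cone K -> K x -> K 0.
Proof. by move=> cK Kx; rewrite -(scale0r x); apply: coneZ. Qed.

Lemma interior_coneD K x y : cone K -> interior K x -> K y -> interior K (x + y).
Proof.
move=> cK /(nbhs_subr y) Kx Ky; apply: filterS Kx => z /= Kz.
by rewrite -(subrK y z); apply: coneD.
Qed.

Lemma interior_coneZ K (a : R) x : cone K -> 0 < a -> interior K x -> interior K (a *: x).
Proof.
move=> cK a0 /(@nbhs_scaler _ _ _ _ _ (lt0r_neq0 a0)) Kx; apply: filterS Kx => z /= Kz.
rewrite -(scale1r z) -(mulfV (lt0r_neq0 a0)) -scalerA; apply: coneZ => //; exact: ltW.
Qed.

Lemma proper_cone_eq0 K x : proper_cone K -> K x -> K (- x) -> x = 0.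
Proof. by move=> [_ H] Kx KNx; have : (K `&` [set x | K (- x)]) x by []; rewrite H. Qed.

(** If 0 were interior, small positive multiples of both [v] and [- v] would lie in [K], against
    properness; [0 < n] makes [v] nonzero. *)
Lemma interior_cone_neq0 K x : (0 < n)%N -> proper_cone K -> interior K x -> x <> 0.
Proof.
move=> n0 pK + x0; rewrite {}x0 => K0.
pose v : 'rV[R]_n := const_mx 1.
have K0e (u : 'rV[R]_n) : \forall a \near 0^'+, K (a *: u).
  by have := nbhs_addZ u K0; apply: filterS => a /=; rewrite add0r.
have : \forall a \near (0 : R)^'+, 0 < a /\ K (a *: v) /\ K (a *: - v).
  near=> a; split; [near: a; exact: nbhs_right_gt|split].
    by near: a; exact: K0e.
  by near: a; exact: K0e.
move=> /filter_ex[a [a0 [K1]]]; rewrite scalerN => K2.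
have /matrixP/(_ 0 (Ordinal n0)) := proper_cone_eq0 pK K1 K2.
by rewrite !mxE mulr1 => a00; move: a0; rewrite a00 ltxx.
Unshelve. all: by end_near. Qed.

Lemma closed_notin_near K x : closed K -> ~ K x -> \forall z \near x, ~ K z.
Proof. by move=> cK Kx; apply: open_nbhs_nbhs; split => //; exact: closed_openC. Qed.

Lemma mx_norm_le (m : nat) (x : 'rV[R]_m) (c : R) :
  0 <= c -> (forall i, `|x 0 i| <= c) -> `|x| <= c.
Proof.
move=> c0 xc; rewrite [leLHS]/Num.norm/= mx_normrE; apply/bigmax_leP; split => //= -[i j] _.
by rewrite (ord1 i).
Qed.

Lemma pairing_delta (a : R) i x : pairing (a *: delta_mx i 0) x = a * x 0 i.
Proof.
rewrite pairingE (bigD1 i)//= big1 ?addr0; first by rewrite !mxE !eqxx mulr1 mulrC.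
by move=> j /negbTE ji; rewrite !mxE ji mulr0 mulr0.
Qed.

Lemma pairingBl phi psi x : pairing (phi - psi) x = pairing phi x - pairing psi x.
Proof. by rewrite !pairingE -sumrB; apply: eq_bigr => j _; rewrite !mxE mulrBr. Qed.

(** An interior functional stays in the dual cone after a small signed multiple of a coordinate is
    subtracted. Hence it dominates every coordinate of a cone vector, and so the sup norm. *)
Lemma pairing_dual_interior K phi : interior (dual_cone K) phi ->
  exists2 k : R, 0 < k & forall x, K x -> `|x| <= k * pairing phi x.
Proof.
move=> /nbhs_ballP[e /= e0 He]; exists (2 / e); first by rewrite divr_gt0.
move=> x Kx; have H i : `|x 0 i| <= 2 / e * pairing phi x.
  have : dual_cone K (phi - (e / 2 * Num.sg (x 0 i)) *: delta_mx i 0).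
    apply: He; split => // j k; rewrite !mxE /ball/= opprB addrC subrK.
    rewrite normrM (_ : `|(_ && _)%:R| = (j == i)%:R :> R); last first.
      by rewrite (ord1 k) eqxx andbT; case: (j == i); rewrite ?normr1 ?normr0.
    rewrite normrM normr_sg ger0_norm; last by lra.
    by case: (_ != 0) => /=; case: (j == i) => /=; rewrite ?mulr1 ?mulr0 //; lra.
  move=> /(_ _ Kx); rewrite pairingBl pairing_delta -(mulrA (e / 2)) -normrEsg subr_ge0.
  by move=> h; rewrite mulrAC ler_pdivlMr//; lra.
apply: mx_norm_le => //; rewrite mulr_ge0 ?divr_ge0 ?(ltW e0)//.
by apply: (interior_subset (A := dual_cone K)) => //; apply/nbhs_ballP; exists e.
Qed.

Lemma pairing_gt0 K phi x : interior (dual_cone K) phi -> K x -> x <> 0 -> 0 < pairing phi x.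
Proof.
move=> /pairing_dual_interior[k k0 /(_ x) H] Kx /eqP x0.
by rewrite -(pmulr_rgt0 _ k0); apply: lt_le_trans (H Kx); rewrite normr_gt0.
Qed.

Lemma pairing_ge0 K phi x : interior (dual_cone K) phi -> K x -> 0 <= pairing phi x.
Proof. by move=> /interior_subset; exact. Qed.

Lemma norm_zero (N : 'rV[R]_n -> R) : is_norm N -> N 0 = 0.
Proof. by case=> _ NZ _; rewrite -(scale0r (0 : 'rV[R]_n)) NZ normr0 mul0r. Qed.

Lemma norm_ge0 (N : 'rV[R]_n -> R) x : is_norm N -> 0 <= N x.
Proof.
move=> NN; have [ND NZ _] := NN; have := ND x (- x).
by rewrite subrr (norm_zero NN) -scaleN1r NZ normrN1 mul1r; lra.
Qed.

(** Expansion in the standard basis gives the constant. This transfers convergence in the sup norm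
    to [N]. *)
Lemma norm_bound (N : 'rV[R]_n -> R) : is_norm N ->
  exists2 M : R, 0 <= M & forall x, N x <= M * `|x|.
Proof.
move=> NN; have [ND NZ _] := NN.
have Nsum (r : seq 'I_n) (f : 'I_n -> 'rV[R]_n) :
    N (\sum_(i <- r) f i) <= \sum_(i <- r) N (f i).
  elim/big_ind2 : _ => [|a b c e ab ce|//]; first by rewrite norm_zero.
  exact: le_trans (ND _ _) (lerD ab ce).
exists (\sum_i N (delta_mx 0 i)).
  by apply: sumr_ge0 => i _; exact: norm_ge0.
move=> x; rewrite {1}(row_sum_delta x) (le_trans (Nsum _ _))// mulr_suml.
apply: ler_sum => i _; rewrite NZ mulrC ler_wpM2l//; first exact: norm_ge0.
rewrite [leRHS]/Num.norm/= mx_normrE.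
exact: (le_bigmax _ (fun ij : 'I_1 * 'I_n => `|x ij.1 ij.2|) (0, i)).
Qed.

(** Bounded because [phi] dominates the norm on [K]. The section meets every ray of the cone, so it
    serves as a compact model of the cone up to scaling. *)
Lemma cone_section_compact K phi : closed K -> interior (dual_cone K) phi ->
  compact (K `&` [set x | pairing phi x = 1]).
Proof.
move=> cK /pairing_dual_interior[k k0 H]; apply: bounded_closed_compact.
  exists k; split; first exact: num_real.
  by move=> M kM x [Kx /= x1]; apply: le_trans (H _ Kx) _; rewrite x1 mulr1 ltW.
apply: closedI => //; have := @closed_comp _ _ (pairing phi) [set 1].
by apply => [x _|]; [exact: pairing_continuous|exact: closed_eq].
Qed.

End ConeTheory.

(* The Hilbert distance of [x] and [y] is at most [- ln c]. *)
Definition hilbert_close (R : realType) (n : nat) (K : set 'rV[R]_n) (c : R)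
    (x y : 'rV[R]_n) : Prop :=
  exists2 s : R, 0 <= s & K (x - s *: y) /\ K (s *: y - c *: x).

(** * Closeness in the Hilbert metric and the action of monotone maps on it *)

Section HilbertClose.
Context (R : realType) (n : nat).
Implicit Types (K L : set 'rV[R]_n) (x y : 'rV[R]_n) (phi : 'cV[R]_n) (c s : R).

Lemma hilbert_closeW K c c' x y : cone K -> K x -> c <= c' ->
  hilbert_close K c' x y -> hilbert_close K c x y.
Proof.
move=> cK Kx cc' [s s0 [K1 K2]]; exists s => //; split => //.
rewrite (_ : _ - _ = s *: y - c' *: x + (c' - c) *: x); last first.
  by rewrite scalerBl addrA subrK.
by apply: coneD => //; apply: coneZ => //; rewrite subr_ge0.
Qed.

Lemma hilbert_closeZ K c (a b : R) x y : cone K -> 0 < a -> 0 < b ->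
  hilbert_close K c x y -> hilbert_close K c (a *: x) (b *: y).
Proof.
move=> cK a0 b0 [s s0 [K1 K2]]; exists (a * s / b).
  by rewrite divr_ge0 ?mulr_ge0 ?(ltW a0) ?(ltW b0).
have -> : a * s / b *: (b *: y) = a *: (s *: y) by rewrite !scalerA mulfVK ?gt_eqF.
rewrite (_ : c *: _ = a *: (c *: x)) -?scalerBr; last by rewrite !scalerA mulrC.
by split; apply: coneZ => //; exact: ltW.
Qed.

Lemma hilbert_close_le1 K phi c x y : interior (dual_cone K) phi -> K x -> x <> 0 ->
  hilbert_close K c x y -> c <= 1.
Proof.
move=> phiK Kx x0 [s s0 [K1 K2]].
have := pairing_gt0 phiK Kx x0; have := pairing_ge0 phiK K1; have := pairing_ge0 phiK K2.
by rewrite !pairingB !pairingZ => *; nra.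
Qed.

(** Failure of closeness is an open condition: for a fixed scale it is open since [K] is closed, and
    the relevant scales form a compact interval. *)
Lemma hilbert_close_notin_near K phi c x y :
  closed K -> interior (dual_cone K) phi -> K y -> y <> 0 -> ~ hilbert_close K c x y ->
  \forall z \near (c, (x, y)), ~ hilbert_close K z.1 z.2.1 z.2.2.
Proof.
move=> clK phiK Ky y0 nQ; have py := pairing_gt0 phiK Ky y0.
(* If [x - s *: y] lies in [K], then [s] is at most the quotient of the pairings; the added 1 keeps
   [B] an upper bound for nearby pairs. *)
pose B := pairing phi x / pairing phi y + 1.
pose F : set_system (R * ('rV[R]_n * 'rV[R]_n)) := nbhs (c, (x, y)).
have FF : Filter F by exact: nbhs_filter.
have F1 : z.1 @[z --> F] --> c by exact: cvg_fst.
have F21 : z.2.1 @[z --> F] --> x.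
  by apply: (@cvg_comp _ _ _ snd fst F (nbhs (x, y))); [exact: cvg_snd|exact: cvg_fst].
have F22 : z.2.2 @[z --> F] --> y.
  by apply: (@cvg_comp _ _ _ snd snd F (nbhs (x, y))); [exact: cvg_snd|exact: cvg_snd].
have nF : \forall z \near F, 0 < pairing phi z.2.2 /\ pairing phi z.2.1 < B * pairing phi z.2.2.
  have H : B * pairing phi z.2.2 - pairing phi z.2.1 @[z --> F] -->
      B * pairing phi y - pairing phi x.
    apply: cvgB; [apply: cvgMl_tmp|];
      (apply: (@cvg_pairing _ _ _ F _ (fun=> phi)); [exact: cvg_cst|by []]).
  have B0 : 0 < B * pairing phi y - pairing phi x.
    by rewrite /B mulrDl divfK ?gt_eqF// mul1r addrAC subrr add0r.
  have H2 : pairing phi z.2.2 @[z --> F] --> pairing phi y.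
    by apply: (@cvg_pairing _ _ _ F _ (fun=> phi)); [exact: cvg_cst|by []].
  near=> z; split.
    by near: z; exact: (cvgr_gt _ H2).
  rewrite -subr_gt0; near: z; exact: (cvgr_gt _ H).
(* Compactness merges the neighbourhoods found for the single scales into one valid for all scales
   in the interval. *)
have cov : near_covering `[0, B]%classic.
  exact: (compact_near_coveringP _).1 (@segment_compact R 0 B).
have {cov} nB : \forall z \near F, forall s, 0 <= s <= B ->
   ~ (K (z.2.1 - s *: z.2.2) /\ K (s *: z.2.2 - z.1 *: z.2.1)).
  suff H s : `[0, B]%classic s -> \forall s' \near s & z \near F,
      ~ (K (z.2.1 - s' *: z.2.2) /\ K (s' *: z.2.2 - z.1 *: z.2.1)).
    have := cov _ F (fun z s => ~ (K (z.2.1 - s *: z.2.2) /\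
      K (s *: z.2.2 - z.1 *: z.2.1))) FF H.
    by apply: filterS => z {}H t tB; apply: H; rewrite /= in_itv.
  rewrite /= in_itv/= => /andP[s0 sB].
  pose G := filter_prod (nbhs s) F.
  have GF : Filter G by exact: filter_prod_filter.
  have G1 : p.1 @[p --> G] --> s by exact: cvg_fst.
  have G2 : p.2 @[p --> G] --> F by exact: cvg_snd.
  have G21 : p.2.1 @[p --> G] --> c by exact: cvg_comp _ _ G2 F1.
  have G221 : p.2.2.1 @[p --> G] --> x by exact: cvg_comp _ _ G2 F21.
  have G222 : p.2.2.2 @[p --> G] --> y by exact: cvg_comp _ _ G2 F22.
  have [K1|K1] := pselect (K (x - s *: y)); last first.
    have H : \forall p \near G, ~ K (p.2.2.1 - p.1 *: p.2.2.2).
      exact: (cvg_subZ GF G221 G1 G222 (closed_notin_near clK K1)).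
    by apply: filterS H => p /= + [].
  have K2 : ~ K (s *: y - c *: x) by move=> K2; apply: nQ; exists s.
  have H0 : p.1 *: p.2.2.2 @[p --> G] --> s *: y by exact: cvgZ.
  have H : \forall p \near G, ~ K (p.1 *: p.2.2.2 - p.2.1 *: p.2.2.1).
    exact: (cvg_subZ GF H0 G21 G221 (closed_notin_near clK K2)).
  by apply: filterS H => p /= + [].
change (\forall z \near F, ~ hilbert_close K z.1 z.2.1 z.2.2).
near=> z; case=> s s0 [K1 K2].
have [] : 0 < pairing phi z.2.2 /\ pairing phi z.2.1 < B * pairing phi z.2.2.
  by near: z.
move=> p0 pB; have := pairing_ge0 phiK K1; rewrite pairingB pairingZ => pK.
have sB : 0 <= s <= B.
  by rewrite s0/= -(ler_pM2r p0); lra.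
have : ~ (K (z.2.1 - s *: z.2.2) /\ K (s *: z.2.2 - z.1 *: z.2.1)).
  by move: s sB {s0 K1 K2 pK}; near: z.
by apply.
Unshelve. all: by end_near. Qed.

Lemma homogeneous0 K (E : 'rV[R]_n -> 'rV[R]_n) x : cone K -> K x ->
  (forall a z, 0 < a -> K z -> E (a *: z) = a *: E z) -> E 0 = 0.
Proof.
move=> cK Kx /(_ 2 0 (ltr0Sn _ _) (cone0 cK Kx)); rewrite scaler0 scaler_nat mulr2n.
by move/eqP; rewrite -subr_eq0 opprD addrA subrr sub0r oppr_eq0 => /eqP.
Qed.

Lemma homogeneousZ K (E : 'rV[R]_n -> 'rV[R]_n) (a : R) x : cone K -> K x -> 0 <= a ->
  (forall a z, 0 < a -> K z -> E (a *: z) = a *: E z) -> E (a *: x) = a *: E x.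
Proof.
move=> cK Kx a0 hE; move: a0; rewrite le_eqVlt => /predU1P[<-|a0]; last exact: hE.
by rewrite !scale0r; exact: (homogeneous0 cK Kx hE).
Qed.

(** The same scale [s] works: homogeneity moves [s] and [c] through [E], and monotonicity preserves
    both inequalities. *)
Lemma hilbert_close_image K L (E : 'rV[R]_n -> 'rV[R]_n) c x y : cone K -> K x -> K y ->
  (forall a z, 0 < a -> K z -> E (a *: z) = a *: E z) ->
  (forall u v, K u -> K v -> K (v - u) -> L (E v - E u)) ->
  0 <= c -> hilbert_close K c x y -> hilbert_close L c (E x) (E y).
Proof.
move=> cK Kx Ky hE mE c0 [s s0 [K1 K2]]; exists s => //.
rewrite -(homogeneousZ cK Ky s0 hE) -(homogeneousZ cK Kx c0 hE).
by split; apply: mE => //; exact: coneZ.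
Qed.

(** Since [r < 1], the scale can be chosen so that both comparisons are between distinct vectors,
    which is the input that strict monotonicity requires. *)
Lemma hilbert_close_strict K r x y : proper_cone K -> interior K x -> x <> 0 ->
  K y -> y <> 0 -> 0 <= r < 1 -> hilbert_close K r x y ->
  exists2 s : R, 0 < s & cone_prec K (s *: y) x /\ cone_prec K (r *: x) (s *: y).
Proof.
move=> pK Kox x0 Ky y0 /andP[r0 r1] [s s0 [K1 K2]].
have cK := pK.1; have Kx := interior_subset Kox.
(* For proportional vectors, any scale strictly between [r * m] and [m] works; the midpoint is
   taken. *)
have prop (m : R) : 0 < m -> x = m *: y -> exists2 s : R, 0 < s &
    cone_prec K (s *: y) x /\ cone_prec K (r *: x) (s *: y).
  move=> m0 xmy; exists (m * ((1 + r) / 2)); first by rewrite mulr_gt0//; lra.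
  rewrite mulrC -scalerA -xmy; split; split.
  - rewrite /cone_le -{1}(scale1r x) -scalerBl; apply: coneZ => //; lra.
  - rewrite -[RHS]scale1r => /eqP; rewrite -subr_eq0 -scalerBl scaler_eq0.
    by rewrite lt_eqF => [/eqP//|]; rewrite subr_lt0; lra.
  - rewrite /cone_le -scalerBl; apply: coneZ => //; lra.
  - move/eqP; rewrite -subr_eq0 -scalerBl scaler_eq0.
    by rewrite lt_eqF => [/eqP//|]; rewrite subr_lt0; lra.
have [xsy|xsy] := eqVneq x (s *: y).
  apply: (prop s) => //; rewrite lt_neqAle s0 andbT eq_sym; apply/eqP => s00.
  by apply: x0; rewrite xsy s00 scale0r.
have [rxsy|rxsy] := eqVneq (r *: x) (s *: y); last first.
  exists s; last by split; split => //; [move=> h; rewrite h eqxx in xsy|exact/eqP].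
  rewrite lt_neqAle s0 andbT eq_sym; apply: contraNneq rxsy => s00.
  rewrite s00 scale0r; apply/eqP; apply: (proper_cone_eq0 pK); first exact: coneZ.
  by move: K2; rewrite s00 scale0r sub0r.
move: r0; rewrite le_eqVlt => /predU1P[r00|r0]; last first.
  apply: (prop (s / r)).
    rewrite divr_gt0// lt_neqAle s0 andbT eq_sym; apply/eqP => s00.
    move: rxsy => /eqP; rewrite s00 scale0r scaler_eq0 => /orP[|/eqP//].
    by rewrite gt_eqF.
  by rewrite mulrC -scalerA -rxsy scalerA mulVf ?gt_eqF// scale1r.
(* Remaining case [r = 0] and [s *: y = 0]: as [x] is interior, a small positive scale [a] is
   admissible, and halving it rules out equality with [x]. *)
have : \forall a \near (0 : R)^'+, 0 < a /\ K (x + a *: - y).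
  near=> a; split; near: a; [exact: nbhs_right_gt|exact: nbhs_addZ].
move=> /filter_ex[a [a0]]; rewrite scalerN => Ka.
have a20 : 0 < a / 2 by lra.
have hy : x - (a / 2) *: y = x - a *: y + (a / 2) *: y.
  have -> : a *: y = (a / 2) *: y + (a / 2) *: y by rewrite -scalerDl -splitr.
  by rewrite opprD addrA subrK.
exists (a / 2) => //; split; split.
- by rewrite /cone_le hy; apply: coneD => //; apply: coneZ => //; exact: ltW.
- move=> /esym/eqP; rewrite -subr_eq0 hy => /eqP h.
  have /eqP : (a / 2) *: y = 0.
    apply: (proper_cone_eq0 pK); first exact: coneZ (ltW _) _.
    by move/eqP: h; rewrite addr_eq0 => /eqP <-.
  by rewrite scaler_eq0 gt_eqF//= => /eqP.
- by rewrite /cone_le -r00 scale0r subr0; apply: coneZ => //; exact: ltW.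
- by rewrite -r00 scale0r => /esym/eqP; rewrite scaler_eq0 gt_eqF//= => /eqP.
Unshelve. all: by end_near. Qed.

(** The gain [e] is found near each pair of points of [Z] and made uniform by compactness of [Z]
    times [Z]. The premise is weakened to [r - e] so that the lemma applies to coefficients merely
    approaching [r]. *)
Lemma strictly_monotone_expand K L phi (E : 'rV[R]_n -> 'rV[R]_n) (Z : set 'rV[R]_n) r :
  (0 < n)%N -> solid_cone K -> interior (dual_cone K) phi ->
  (forall a z, 0 < a -> K z -> E (a *: z) = a *: E z) ->
  strictly_monotone K L E ->
  compact Z -> Z `<=` interior K -> (forall x, Z x -> {for x, continuous E}) ->
  0 <= r < 1 ->
  \forall e \near (0 : R)^'+, forall x y, Z x -> Z y ->
    hilbert_close K (r - e) x y -> hilbert_close L (r + e) (E x) (E y).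
Proof.
move=> n0 [pK clK _] phiK hE sE Zc ZK Ec r01; have cK := pK.1.
have : near_covering (Z `*` Z) by exact/compact_near_coveringP/compact_setX.
move=> /(_ _ (0^'+) (fun e p => hilbert_close K (r - e) p.1 p.2 ->
   hilbert_close L (r + e) (E p.1) (E p.2)) _) cov.
suff : \forall e \near (0 : R)^'+, (Z `*` Z) `<=` (fun p => hilbert_close K (r - e) p.1 p.2 ->
   hilbert_close L (r + e) (E p.1) (E p.2)).
  by apply: filterS => e H x y Zx Zy; apply: (H (x, y)).
apply: cov => -[x y] [/= Zx Zy].
pose G := filter_prod (nbhs (x, y)) (0 : R)^'+.
have GF : Filter G by exact: (@filter_prod_filter _ _ (nbhs (x, y)) (0 : R)^'+ _ _).
have G1 : p.1 @[p --> G] --> (x, y) by exact: cvg_fst.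
have G11 : p.1.1 @[p --> G] --> x by exact: cvg_comp _ _ G1 cvg_fst.
have G12 : p.1.2 @[p --> G] --> y by exact: cvg_comp _ _ G1 cvg_snd.
have G2 : p.2 @[p --> G] --> (0 : R).
  move=> A A0; have A0' : (0 : R)^'+ A by exact: (@cvg_within _ (nbhs (0 : R)) _ _ A A0).
  exact: (cvg_snd A0').
have Kx := interior_subset (ZK _ Zx); have Ky := interior_subset (ZK _ Zy).
have x0 := interior_cone_neq0 n0 pK (ZK _ Zx); have y0 := interior_cone_neq0 n0 pK (ZK _ Zy).
(* A pair that is not [r]-close has no [r - e]-close pairs nearby, for small [e]. For an [r]-close
   pair, strictness puts both differences in the interior of [L], which leaves room for [r + e]. *)
have [Q|nQ] := pselect (hilbert_close K r x y); last first.
  have Gr : (r - p.2, p.1) @[p --> G] --> (r, (x, y)).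
    have Gr : r - p.2 @[p --> G] --> r.
      rewrite -[X in _ --> X]subr0; apply: (cvgB (FF := GF)) => //.
      exact: (@cvg_cst _ r _ G GF).
    exact: (@cvg_pair _ _ _ G _ _ GF (nbhs_filter r) (nbhs_filter (x, y)) _ _ Gr G1).
  have H : \forall p \near G, ~ hilbert_close K (r - p.2) p.1.1 p.1.2.
    exact: (Gr _ (hilbert_close_notin_near clK phiK Ky y0 nQ)).
  by apply: filterS H => p.
have [s s0 [P1 P2]] := hilbert_close_strict pK (ZK _ Zx) x0 Ky y0 r01 Q.
have r0 : 0 <= r by case/andP: r01.
have L1 := sE _ _ (coneZ cK (ltW s0) Ky) Kx P1.
have L2 := sE _ _ (coneZ cK r0 Kx) (coneZ cK (ltW s0) Ky) P2.
move: L1 L2; rewrite /cone_lt (homogeneousZ cK Kx r0 hE) (homogeneousZ cK Ky (ltW s0) hE).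
move=> L1 L2.
have E1 : E p.1.1 @[p --> G] --> E x by exact: cvg_comp _ _ G11 (Ec _ Zx).
have E2 : E p.1.2 @[p --> G] --> E y by exact: cvg_comp _ _ G12 (Ec _ Zy).
have cs : s @[p --> G] --> s by exact: cvg_cst.
have cre : r + p.2 @[p --> G] --> r.
  rewrite -[X in _ --> X]addr0; apply: (cvgD (FF := GF)) => //.
  exact: (@cvg_cst _ r _ G GF).
have H1 : \forall p \near G, L (E p.1.1 - s *: E p.1.2).
  exact: (cvg_subZ GF E1 cs E2 L1).
have sE2 : s *: E p.1.2 @[p --> G] --> s *: E y by exact: cvgZ.
have H2 : \forall p \near G, L (s *: E p.1.2 - (r + p.2) *: E p.1.1).
  exact: (cvg_subZ GF sE2 cre E1 L2).
suff : \forall p \near G, hilbert_close L (r + p.2) (E p.1.1) (E p.1.2).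
  by apply: filterS => p.
by near=> p; exists s; [exact: ltW|split; near: p].
Unshelve. all: by end_near. Qed.

End HilbertClose.

(** * Measurable maps into spaces of matrices *)

Section SigmaAlgebra.
Context (Omega : Type) (G : set (set Omega)) (sG : sigma_algebra setT G).

Lemma sigma_setC (A : set Omega) : G A -> G (~` A).
Proof. by case: sG => _ H _ /H; rewrite setTD. Qed.

Lemma sigma_exists (I : countType) (A : I -> set Omega) :
  (forall i, G (A i)) -> G [set w | exists i, A i w].
Proof.
case: sG => G0 _ HU HA.
have := HU (fun k => if unpickle k is Some i then A i else set0).
rewrite (_ : \bigcup_k _ = [set w | exists i, A i w]).
  by apply => k; case: unpickle.
apply/seteqP; split => w /=.
  by case=> k _; case: unpickle => // i Aw; exists i.
by case=> i Aw; exists (pickle i) => //; rewrite pickleK.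
Qed.

Lemma sigma_forall (I : countType) (A : I -> set Omega) :
  (forall i, G (A i)) -> G [set w | forall i, A i w].
Proof.
move=> HA; rewrite (_ : mkset _ = ~` [set w | exists i, (~` A i) w]).
  by apply/sigma_setC/sigma_exists => i; exact: sigma_setC.
apply/seteqP; split => w /= H; first by case=> i; apply.
by move=> i; apply: contrapT => nA; apply: H; exists i.
Qed.

Lemma sigma_setI (A B : set Omega) : G A -> G B -> G (A `&` B).
Proof.
move=> GA GB; rewrite (_ : A `&` B = [set w | forall b : bool, (if b then A else B) w]).
  by apply: sigma_forall => -[].
by apply/seteqP; split => w /= H; [case: H => ? ?; case|split; [exact: (H true)|exact: (H false)]].
Qed.

Lemma sigma_setU (A B : set Omega) : G A -> G B -> G (A `|` B).
Proof.
move=> GA GB; rewrite -(setCK (A `|` B)) setCU; apply: sigma_setC.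
by apply: sigma_setI; exact: sigma_setC.
Qed.

Lemma sigma_cst (Q : Prop) : G [set w | Q].
Proof.
have [q|q] := pselect Q.
  rewrite (_ : mkset _ = ~` set0); first by apply: sigma_setC; case: sG.
  by rewrite setC0; apply/seteqP; split.
by rewrite (_ : mkset _ = set0); [case: sG|apply/seteqP; split].
Qed.

Lemma borel_measurable_open (Y : topologicalType) (f : Omega -> Y) :
  (forall U, open U -> G (f @^-1` U)) -> borel_measurable G f.
Proof.
move=> H; suff : borel_sets Y `<=` [set B | G (f @^-1` B)] by [].
apply: smallest_sub => //; split => /=.
- by rewrite preimage_set0; case: sG.
- by move=> A GA; rewrite setTD preimage_setC; exact: sigma_setC.
- by move=> A GA; rewrite preimage_bigcup; case: sG => _ _; exact.
Qed.

(** Continuity is required only at values of [f]. The preimage of an open [U] under [h] need not be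
    open, but its interior contains the same values of [f]. *)
Lemma borel_measurable_comp (X Y : topologicalType) (f : Omega -> X) (h : X -> Y) :
  (forall w, {for f w, continuous h}) -> borel_measurable G f ->
  borel_measurable G (h \o f).
Proof.
move=> hc mf; apply: borel_measurable_open => U Uo.
rewrite (_ : _ @^-1` _ = f @^-1` (interior (h @^-1` U))).
  by apply: mf; apply: sub_sigma_algebra; exact: open_interior.
apply/seteqP; split => w /=; last by move=> /interior_subset.
by move=> Uw; apply: hc; exact: open_nbhs_nbhs.
Qed.

(** The sets [S] with this property form a sigma-algebra containing the rectangles. *)
Lemma section_measurable (Y : Type) (H : set (set Y)) (S : set (Omega * Y)) (f : Omega -> Y) :
  (forall B, H B -> G (f @^-1` B)) -> prod_sigma_algebra G H S ->
  G [set w | S (w, f w)].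
Proof.
move=> mf; suff : prod_sigma_algebra G H `<=` [set S | G [set w | S (w, f w)]] by exact.
apply: smallest_sub => /=; last first.
  move=> _ [A [B [GA HB ->]]] /=.
  by rewrite (_ : mkset _ = A `&` f @^-1` B)//; exact: sigma_setI (mf _ HB).
split => /=.
- by rewrite (_ : mkset _ = set0); [case: sG|apply/seteqP; split].
- move=> A GA; rewrite (_ : mkset _ = ~` [set w | A (w, f w)]); first exact: sigma_setC.
  by apply/seteqP; split => w /=; [case|].
- move=> A GA; rewrite (_ : mkset _ = \bigcup_k [set w | A k (w, f w)]).
    by case: sG => _ _; exact.
  by apply/seteqP; split => w /=; case=> k _ ?; exists k.
Qed.

Lemma borel_measurable_cst (Y : topologicalType) (y : Y) : borel_measurable G (fun=> y).
Proof. by move=> B _; exact: sigma_cst. Qed.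

Lemma borel_measurable_if (Y : topologicalType) (f g : Omega -> Y) (A : Omega -> bool) :
  G [set w | A w] -> borel_measurable G f -> borel_measurable G g ->
  borel_measurable G (fun w => if A w then f w else g w).
Proof.
move=> GA mf mg B bB.
rewrite (_ : _ @^-1` _ = ([set w | A w] `&` f @^-1` B) `|` (~` [set w | A w] `&` g @^-1` B)).
  apply: sigma_setU; first exact: sigma_setI (mf _ bB).
  exact: sigma_setI (sigma_setC GA) (mg _ bB).
apply/seteqP; split => w /=; first by case: (A w) => ?; [left|right].
by move=> [[Aw]|[/negP/negbTE Aw]]; rewrite Aw.
Qed.

Context (R : realType).

Definition rat_mx m n (q : 'M[rat]_(m, n)) : 'M[R]_(m, n) := map_mx ratr q.

Lemma rat_matrix_dense m n (x : 'M[R]_(m, n)) (e : R) : 0 < e ->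
  exists q : 'M[rat]_(m, n), ball (rat_mx q) e x.
Proof.
move=> e0; have H i j : exists q : rat, `|ratr q - x i j| < e.
  have [q] := rat_in_itvoo (ltr_pwDr e0 (lexx (x i j))).
  rewrite in_itv/= => /andP[q1 q2]; exists q; rewrite gtr0_norm ?subr_gt0//.
  by rewrite ltrBlDl.
exists (\matrix_(i, j) sval (cid (H i j))); split => // i j.
by rewrite !mxE /ball/=; case: cid.
Qed.

(** An open set of the product is a countable union of products of balls with rational centres and
    radii [1 / (k + 1)]. *)
Lemma borel_measurable_pair m n p q (f : Omega -> 'M[R]_(m, n)) (g : Omega -> 'M[R]_(p, q)) :
  borel_measurable G f -> borel_measurable G g ->
  borel_measurable G (fun w => (f w, g w)).
Proof.
move=> mf mg; apply: borel_measurable_open => U Uo.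
pose B (i : 'M[rat]_(m, n) * 'M[rat]_(p, q) * nat) : set ('M[R]_(m, n) * 'M[R]_(p, q)) :=
  ball (rat_mx i.1.1) i.2.+1%:R^-1 `*` ball (rat_mx i.1.2) i.2.+1%:R^-1.
have mb k l (h : Omega -> 'M[R]_(k, l)) (z : 'M[R]_(k, l)) (e : R) : 0 < e ->
    borel_measurable G h -> G [set w | ball z e (h w)].
  move=> e0; apply; apply: sub_sigma_algebra; exact: ball_open.
rewrite (_ : _ @^-1` _ = [set w | exists i, (B i `<=` U) /\ B i (f w, g w)]).
  apply: sigma_exists => i.
  by apply: sigma_setI; [exact: sigma_cst|apply: sigma_setI; apply: mb].
apply/seteqP; split => w /=; last by move=> [i [BU Bi]]; exact: BU.
move=> Uw; have : nbhs (f w, g w) U by exact: open_nbhs_nbhs.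
move=> /nbhs_ballP[e /= e0 He].
have [k ke] : exists k : nat, k.+1%:R^-1 < e / 2.
  have /ltr_add_invr[k] : 0 < e / 2 by rewrite divr_gt0.
  by rewrite add0r; exists k.
have k0 : (0 : R) < k.+1%:R^-1 by rewrite invr_gt0.
have [q1 h1] := rat_matrix_dense (f w) k0.
have [q2 h2] := rat_matrix_dense (g w) k0.
exists (q1, q2, k); split => // -[a b] [/= Ha Hb]; apply: He; split => /=.
- rewrite (splitr e); apply: (@ball_triangle _ _ (rat_mx q1)).
    by apply: ball_sym; exact: le_ball (ltW ke) _ h1.
  exact: le_ball (ltW ke) _ Ha.
- rewrite (splitr e); apply: (@ball_triangle _ _ (rat_mx q2)).
    by apply: ball_sym; exact: le_ball (ltW ke) _ h2.
  exact: le_ball (ltW ke) _ Hb.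
Qed.

(** The limit lies in an open [U] exactly when, for some [k], the sequence eventually stays in the
    closed set [C k] of points whose ball of radius [1 / (k + 1)] is inside [U]. *)
Lemma borel_measurable_cvg m n (f : nat -> Omega -> 'M[R]_(m, n)) (g : Omega -> 'M[R]_(m, n)) :
  (forall t, borel_measurable G (f t)) -> (forall w, f t w @[t --> \oo] --> g w) ->
  borel_measurable G g.
Proof.
move=> mf fg; apply: borel_measurable_open => U Uo.
pose C (k : nat) := [set x : 'M[R]_(m, n) | ball x k.+1%:R^-1 `<=` U].
have Ccl k : closed (C k).
  rewrite -openC openE => x /= /existsNP[y /not_implyP[yb yU]].
  have : nbhs x [set z | ball y k.+1%:R^-1 z].
    by apply: open_nbhs_nbhs; split; [apply: ball_open|exact: ball_sym].
  by apply: filterS => z /= zb /(_ y (ball_sym zb)).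
rewrite (_ : _ @^-1` _ = [set w | exists i : nat * nat,
    forall t, (i.2 <= t)%N -> C i.1 (f t w)]).
  apply: sigma_exists => i; apply: sigma_forall => t.
  rewrite (_ : (fun w => _) = [set w | (t < i.2)%N] `|` f t @^-1` C i.1); last first.
    apply/seteqP; split => w /=; last by case=> [ti|//]; rewrite leqNgt ti.
    by have [it|it] := leqP i.2 t; [move=> /(_ isT); right|left].
  apply: sigma_setU; first exact: sigma_cst.
  rewrite -(setCK (_ @^-1` _)); apply: sigma_setC; rewrite preimage_setC.
  by apply: mf; apply: sub_sigma_algebra; exact: closed_openC.
apply/seteqP; split => w /=.
  move=> Uw; have : nbhs (g w) U by exact: open_nbhs_nbhs.
  move=> /nbhs_ballP[e /= e0 He].
  have [k ke] : exists k : nat, k.+1%:R^-1 < e / 2.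
    have /ltr_add_invr[k] : 0 < e / 2 by rewrite divr_gt0.
    by rewrite add0r; exists k.
  have : \forall t \near \oo, ball (g w) (e / 2) (f t w).
    by apply: fg; apply: nbhsx_ballx; rewrite divr_gt0.
  move=> [N _ HN]; exists (k, N) => t /= /HN bt y yb; apply: He.
  rewrite (splitr e); apply: ball_triangle bt _; exact: le_ball (ltW ke) _ yb.
move=> [[k N] /= H]; have : C k (g w).
  apply: (@closed_cvg _ _ \oo _ (fun t => f t w) (C k) (Ccl k)) (fg w).
  by exists N => // t /= /H.
by apply; apply: ballxx; rewrite invr_gt0.
Qed.

End SigmaAlgebra.

(** * Cocycles of monotone maps *)

Section Continuity.
Context (R : realType) (n : nat).
Implicit Types (K : set 'rV[R]_n) (x : 'rV[R]_n).

Lemma interior_continuous K (E : 'rV[R]_n -> 'rV[R]_n) x :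
  {within K, continuous E} -> interior K x -> {for x, continuous E}.
Proof.
move=> /subspace_continuousP Ec Kx A /(Ec _ (interior_subset Kx)).
rewrite /within/= => H; have {}H : nbhs x (fun z => K z -> A (E z)) := H.
change (nbhs x (E @^-1` A)).
by apply: filterS2 Kx H => z Kz; exact.
Qed.

Lemma within_continuous_comp K L (E E' : 'rV[R]_n -> 'rV[R]_n) :
  (forall x, K x -> L (E x)) -> {within K, continuous E} -> {within L, continuous E'} ->
  {within K, continuous (E' \o E)}.
Proof.
move=> KL /subspace_continuousP Ec /subspace_continuousP Ec'.
apply/subspace_continuousP => x Kx A /(Ec' _ (KL _ Kx)); rewrite /within/= => H.
have H2 : nbhs x (fun z => K z -> L (E z) -> A (E' (E z))) := Ec _ Kx _ H.
change (nbhs x (fun z => K z -> A (E' (E z)))).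
by apply: filterS H2 => z /= H2 Kz; exact: H2 (KL _ Kz).
Qed.

(** Moving [x] slightly towards an interior point [e] of the cone gives an interior point, and
    rational points are dense around that one. *)
Lemma rat_dense_cone K x (U : set 'rV[R]_n) : solid_cone K -> K x -> x <> 0 ->
  within K (nbhs x) U -> exists q : 'rV[rat]_n, [/\ K (rat_mx R q), rat_mx R q <> 0 & U (rat_mx R q)].
Proof.
move=> [[cK _] _ [e Ke]] Kx x0; rewrite /within/= => HU.
have x0' : \forall z \near x, z <> 0.
  apply: (@closed_notin_near _ _ [set 0]) => //.
  by apply: accessible_closed_set1; apply: hausdorff_accessible; exact: norm_hausdorff.
pose A := [set z | z <> 0 /\ (K z -> U z)].
have Ax : nbhs x A by apply: filterI.
have Aint : nbhs x (interior A) by exact: nbhs_interior.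
have : \forall a \near (0 : R)^'+, 0 < a /\ interior A (x + a *: e).
  near=> a; split; near: a; [exact: nbhs_right_gt|exact: nbhs_addZ].
move=> /filter_ex[a [a0 HA]].
have HK : interior K (x + a *: e).
  by rewrite addrC; apply: interior_coneD => //; exact: interior_coneZ.
have : nbhs (x + a *: e) (A `&` K) by exact: filterI.
move=> /nbhs_ballP[d /= d0 Hd].
have [q /ball_sym/Hd[[q0 qU] Kq]] := rat_matrix_dense (x + a *: e) d0.
by exists q; split => //; exact: qU.
Unshelve. all: by end_near. Qed.

End Continuity.

(** * Contraction of the cocycle along a single orbit *)

Section Dynamics.
Context (R : realType) (n : nat) (n_gt0 : (0 < n)%N) (Omega : Type)
  (T Tinv : Omega -> Omega) (TK : cancel T Tinv) (TinvK : cancel Tinv T)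
  (K : Omega -> set 'rV[R]_n) (K_solid : forall w, solid_cone (K w))
  (D : Omega -> 'rV[R]_n -> 'rV[R]_n)
  (D_maps : forall w x, K w x -> K (T w) (D w x))
  (phi : Omega -> 'cV[R]_n)
  (phi_int : forall w, interior (dual_cone (K w)) (phi w))
  (D_cont : forall w, {within K w, continuous (D w)})
  (D_homog : forall w (lambda : R) x, 0 < lambda -> K w x ->
       D w (lambda *: x) = lambda *: D w x)
  (D_mono : forall w, completely_monotone (K w) (K (T w)) (D w)).

Let Kcone w : cone (K w). Proof. by case: (K_solid w) => -[]. Qed.
Let Kproper w : proper_cone (K w). Proof. by case: (K_solid w). Qed.
Let Kclosed w : closed (K w). Proof. by case: (K_solid w). Qed.
Let K0 w : K w 0.
Proof. by case: (K_solid w) => _ _ [x /interior_subset]; exact: cone0. Qed.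

Lemma cone_interior_neq0 w : exists2 x, interior (K w) x & x <> 0.
Proof.
have [_ _ [x Kx]] := K_solid w; exists x => //.
exact: interior_cone_neq0 Kx.
Qed.

Lemma iterTK t w : iter t T (iter t Tinv w) = w.
Proof. by elim: t w => //= t IH w; rewrite -(iterS t Tinv) iterSr IH TinvK. Qed.

Lemma iterTinvK t w : iter t Tinv (iter t T w) = w.
Proof. by elim: t w => //= t IH w; rewrite -(iterS t T) iterSr IH TK. Qed.

Notation C := (cocycle T D).

Lemma cocycleD s t w x : C (s + t) w x = C s (iter t T w) (C t w x).
Proof. by elim: s => //= s ->; rewrite iterD. Qed.

Lemma cocycle_maps t w x : K w x -> K (iter t T w) (C t w x).
Proof. by move=> Kx; elim: t => //= t IH; exact: D_maps. Qed.

Lemma cocycle_homog t w (a : R) x : 0 < a -> K w x -> C t w (a *: x) = a *: C t w x.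
Proof.
by move=> a0 Kx; elim: t => //= t ->; rewrite D_homog//; exact: cocycle_maps.
Qed.

Lemma cocycle_mono t w : completely_monotone (K w) (K (iter t T w)) (C t w).
Proof.
elim: t => [//|t IH] x y Kx Ky /=.
have [I1 I2 I3] := IH _ _ Kx Ky.
have [D1 D2 D3] := D_mono (cocycle_maps t Kx) (cocycle_maps t Ky).
by split => [/I1/D1|/I2/D2|/I3/D3].
Qed.

Lemma cocycle0 t w : C t w 0 = 0.
Proof. by apply: (@homogeneous0 _ _ (K w) (C t w) 0) => // a z; exact: cocycle_homog. Qed.

(** Homogeneity fixes the origin, so monotonicity applied to the pair [0], [x] gives the claim. *)
Lemma cocycle_neq0 t w x : K w x -> x <> 0 -> C t w x <> 0.
Proof.
move=> Kx x0; have [_ H _] := cocycle_mono t (K0 w) Kx.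
have [|_] := H; last by rewrite cocycle0 => h1 h2; exact: h1.
by split; [rewrite /cone_le subr0|exact/nesym].
Qed.

Lemma cocycle_interior t w x : interior (K w) x -> interior (K (iter t T w)) (C t w x).
Proof.
move=> Kx; have [_ _ H] := cocycle_mono t (K0 w) (interior_subset Kx).
by move: H; rewrite /cone_lt cocycle0 !subr0; exact.
Qed.

Lemma cocycle_continuous t w : {within K w, continuous (C t w)}.
Proof.
elim: t => [|t IH]; first by apply: continuous_subspaceT => x; exact: cvg_id.
exact: within_continuous_comp (@cocycle_maps t w) IH (@D_cont (iter t T w)).
Qed.

(* C(t, T^-t w) *)
Definition back t w x := C t (iter t Tinv w) x.

Lemma back_maps t w x : K (iter t Tinv w) x -> K w (back t w x).
Proof. by move=> /(cocycle_maps t); rewrite iterTK. Qed.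

Lemma back_neq0 t w x : K (iter t Tinv w) x -> x <> 0 -> back t w x <> 0.
Proof. exact: cocycle_neq0. Qed.

Lemma backS t w x : back t.+1 w x = D (Tinv w) (back t (Tinv w) x).
Proof. by rewrite /back iterSr /= iterTK. Qed.

Lemma backD s t w x : back (s + t) w x = back s w (back t (iter s Tinv w) x).
Proof. by rewrite /back cocycleD addnC iterD iterTK. Qed.

Lemma back_iter s t w x : back (s + t) (iter s T w) x = C s w (back t w x).
Proof. by rewrite /back cocycleD addnC iterD iterTinvK iterTK. Qed.

(** In terms of the Hilbert metric, the image of the nonzero vectors of the cone under C(t, T^-t w)
    has diameter at most [- ln c]. *)
Definition contracts t w c := forall x y, K (iter t Tinv w) x -> x <> 0 ->
  K (iter t Tinv w) y -> y <> 0 -> hilbert_close (K w) c (back t w x) (back t w y).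

Lemma contractsW t w c c' : c <= c' -> contracts t w c' -> contracts t w c.
Proof.
move=> cc' H x y Kx x0 Ky y0; apply: hilbert_closeW (H _ _ Kx x0 Ky y0) => //.
exact: back_maps.
Qed.

(** Starting further in the past only shrinks the image at [w]. *)
Lemma contracts_addr t s w c : contracts t w c -> contracts (t + s) w c.
Proof.
move=> H x y; rewrite addnC iterD => Kx x0 Ky y0; rewrite addnC !backD.
by apply: H; [exact: back_maps|exact: back_neq0|exact: back_maps|exact: back_neq0].
Qed.

Lemma contracts0 w : contracts 0 w 0.
Proof. by move=> x y Kx x0 Ky y0; exists 0; rewrite // !scale0r !subr0. Qed.

Lemma contracts_le1 t w c : contracts t w c -> c <= 1.
Proof.
move=> H; have [x /interior_subset Kx x0] := cone_interior_neq0 (iter t Tinv w).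
by apply: hilbert_close_le1 (phi_int w) _ _ (H _ _ Kx x0 Kx x0);
  [exact: back_maps|exact: back_neq0].
Qed.

(** Pushing the image at [w] forward by C(s, w) does not decrease closeness. *)
Lemma contracts_shift s t w c : 0 <= c -> contracts t w c -> contracts (s + t) (iter s T w) c.
Proof.
move=> c0 H x y; rewrite addnC iterD iterTinvK => Kx x0 Ky y0; rewrite addnC !back_iter.
apply: (@hilbert_close_image _ _ (K w)) => //; try exact: back_maps.
- by move=> a z; exact: cocycle_homog.
- by move=> u v Ku Kv; have [] := cocycle_mono s Ku Kv.
- exact: H.
Qed.

(* The coefficient of C(t, T^-t w) exceeds [c] for large t; the slack between [c]
   and [c'] is what allows [exceedsE] to restrict the scaling factors to rationals. *)
Definition exceeds (c : rat) w := exists (t : nat) (c' : rat), c < c' /\ contracts t w (ratr c').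

Lemma exceeds_shift c w : 0 <= c -> exceeds c w -> exceeds c (T w).
Proof.
move=> c0 [t [c' [cc' H]]]; exists (1 + t)%N, c'; split => //.
by apply: (@contracts_shift 1) => //; rewrite ler0q (le_trans c0) ?ltW.
Qed.

(* The orbit of [w] avoids the null sets where the limit coefficient is not
   T-invariant or where no iterate is strictly monotone. *)
Definition regular w := forall t : nat,
  (forall c, 0 <= c -> exceeds c (T (iter t T w)) -> exceeds c (iter t T w)) /\
  exists l, strictly_monotone (K (iter t T w)) (K (iter l T (iter t T w))) (C l (iter t T w)).

Lemma regular_iter l w : regular w -> regular (iter l T w).
Proof. by move=> H t; rewrite -iterD; exact: H. Qed.

Lemma regular_exceeds l c w : regular w -> 0 <= c -> exceeds c (iter l T w) -> exceeds c w.
Proof.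
move=> rw c0; elim: l => //= l IH H; apply: IH.
by have [+ _] := rw l; apply.
Qed.

Lemma contracts_exceeds t w (c : rat) (c' : R) : ratr c < c' -> contracts t w c' -> exceeds c w.
Proof.
move=> cc' H; have [q] := rat_in_itvoo cc'; rewrite in_itv/= => /andP[q1 q2].
by exists t, q; split; [rewrite ltr_rat in q1|exact: contractsW (ltW q2) H].
Qed.

(** The first strictly monotone block gives compactness, the second gives the gain. The gain [e]
    does not depend on [t]. *)
Lemma contracts_expand w l l' r :
  strictly_monotone (K w) (K (iter l T w)) (C l w) ->
  strictly_monotone (K (iter l T w)) (K (iter l' T (iter l T w))) (C l' (iter l T w)) ->
  0 <= r < 1 ->
  \forall e \near (0 : R)^'+, forall t, contracts (t + l) (iter l T w) (r - e) ->
    contracts (l' + (t + l)) (iter l' T (iter l T w)) (r + e).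
Proof.
set w1 := iter l T w; set w2 := iter l' T w1 => sl sl' r01.
pose S := K w `&` [set x | pairing (phi w) x = 1].
have SE x : K w x -> x <> 0 -> exists2 z, S z & x = pairing (phi w) x *: z.
  move=> Kx x0; have p0 := pairing_gt0 (phi_int w) Kx x0.
  exists ((pairing (phi w) x)^-1 *: x); last by rewrite scalerA mulfV ?gt_eqF// scale1r.
  split; first by apply: coneZ => //; rewrite invr_ge0 ltW.
  by rewrite /= pairingZ mulVf// gt_eqF.
(* [Z] is compact as an image of the section, and interior because strict monotonicity compares 0
   with each point of the section. *)
pose Z := C l w @` S.
have ZK : Z `<=` interior (K w1).
  move=> _ [x [Kx x1] <-]; have := sl _ _ (K0 w) Kx.
  rewrite /cone_lt cocycle0 subr0; apply; split; first by rewrite /cone_le subr0.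
  by move=> x0; move: x1; rewrite /= -x0 pairing0 => /eqP; rewrite eq_sym oner_eq0.
have Zc : compact Z.
  apply: continuous_compact; last exact: cone_section_compact (phi_int w).
  have SK : S `<=` K w by move=> x [].
  exact: (continuous_subspaceW SK (@cocycle_continuous l w)).
have := strictly_monotone_expand n_gt0 (K_solid w1) (phi_int w1) (@cocycle_homog l' w1)
  sl' Zc ZK (fun x Zx => interior_continuous (@cocycle_continuous l' w1) (ZK _ Zx)) r01.
apply: filterS => e He t Ht x y.
rewrite (addnC l') iterD /w2 iterTinvK => Kx x0 Ky y0; rewrite (addnC (t + l)%N) !back_iter.
(* C(l, w) acts last, so every image point is a positive multiple of a point of [Z]. *)
have E z : K (iter (t + l) Tinv w1) z -> z <> 0 -> exists a u, [/\ 0 < a, Z u &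
    back (t + l) w1 z = a *: u].
  rewrite iterD {1}/w1 iterTinvK => Kz z0; rewrite addnC /w1 back_iter.
  have Kb := back_maps Kz; have b0 := back_neq0 Kz z0.
  have [v Sv bv] := SE _ Kb b0; have p0 := pairing_gt0 (phi_int w) Kb b0.
  exists (pairing (phi w) (back t w z)), (C l w v); split => //; first by exists v.
  by rewrite [in LHS]bv cocycle_homog//; case: Sv.
have := Ht _ _ Kx x0 Ky y0.
have [a [u [a0 Zu ->]]] := E _ Kx x0; have [b [v [b0 Zv ->]]] := E _ Ky y0.
have Kw1 z : Z z -> K w1 z by move=> /ZK/interior_subset.
move=> Q; rewrite !cocycle_homog//; [|exact: Kw1..].
apply: hilbert_closeZ => //; apply: He => //.
have a0' : 0 < a^-1 by rewrite invr_gt0.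
have b0' : 0 < b^-1 by rewrite invr_gt0.
have := hilbert_closeZ (@Kcone w1) a0' b0' Q.
by rewrite !scalerA !mulVf ?gt_eqF// !scale1r.
Qed.

(** The supremum of the coefficients is studied at [w1], after one strictly monotone block;
    regularity carries lower bounds back along the orbit. *)
Lemma regular_contracts w (c : R) : regular w -> c < 1 -> exists t, contracts t w c.
Proof.
move=> rw c1; have [_ [l sl]] := rw 0%N; pose w1 := iter l T w.
have rw1 : regular w1 by exact: regular_iter.
have [_ [l' sl']] := rw1 0%N.
pose A := [set c : R | 0 <= c /\ exists t, contracts t w1 c].
have A0 : A 0 by split => //; exists 0%N; exact: contracts0.
have Aub : ubound A 1 by move=> x [_ [t]]; exact: contracts_le1.
have Asup : has_sup A by split; [exists 0|exists 1].
have leA c' : A c' -> c' <= sup A by move: c'; apply/ubP; exact: ub_le_sup Asup.2.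
have s0 := leA _ A0.
(* If the supremum is at least 1, a rational [q] between [Num.max 0 c] and 1 is exceeded at [w1],
   hence at [w]. *)
have [s1|s1] := ltP (sup A) 1; last first.
  have m1 : Num.max 0 c < 1 by rewrite gt_max ltr01.
  have [q] := rat_in_itvoo m1.
  rewrite in_itv/= gt_max => /andP[/andP[q0 cq] q1].
  have [c' [c'0 [t Ht]] qc'] := sup_gt Asup.1 (lt_le_trans q1 s1).
  have /(regular_exceeds rw) : exceeds q (iter l T w) by exact: contracts_exceeds Ht.
  move=> [|t' [c2 [qc2 H2]]]; first by rewrite ltr0q in q0; exact: ltW.
  exists t'; apply: contractsW H2; apply/ltW/(lt_trans cq).
  by rewrite ltr_rat.
(* Below 1, a coefficient within [e] of the supremum grows past it after the second block; pulled
   back to [w1], it contradicts the supremum. *)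
exfalso.
have r01 : 0 <= sup A < 1 by rewrite s0.
have : \forall e \near (0 : R)^'+, 0 < e /\ forall t, contracts (t + l) w1 (sup A - e) ->
    contracts (l' + (t + l)) (iter l' T w1) (sup A + e).
  near=> e; split; near: e; [exact: nbhs_right_gt|exact: contracts_expand].
move=> /filter_ex[e [e0 He]].
have [c' [c'0 [t Ht]] ec'] := sup_adherent e0 Asup.
have /He H2 : contracts (t + l) w1 (sup A - e).
  by apply: contracts_addr; exact: contractsW (ltW ec') Ht.
have [q] := rat_in_itvoo (ltr_pwDr e0 (lexx (sup A))).
rewrite in_itv/= => /andP[q1 q2].
have q0 : 0 <= q by rewrite -(ler0q R); apply: le_trans s0 (ltW q1).
have /(regular_exceeds rw1 q0) : exceeds q (iter l' T w1) by exact: contracts_exceeds H2.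
move=> [t' [c2 [qc2 H3]]].
have Ac2 : A (ratr c2).
  by split; [rewrite ler0q (le_trans q0)// ltW|exists t'].
have := leA _ Ac2; apply/negP; rewrite -ltNge (lt_trans q1)//.
by rewrite ltr_rat.
Unshelve. all: by end_near. Qed.

(** A version of [contracts] with countable quantifiers, over rational test vectors and rational
    scales, so that measurability can be read off. *)
Definition rat_contracts t w (c : R) := forall p : 'rV[rat]_n * 'rV[rat]_n,
  (K (iter t Tinv w) (rat_mx R p.1) /\ rat_mx R p.1 <> 0) /\
    (K (iter t Tinv w) (rat_mx R p.2) /\ rat_mx R p.2 <> 0) ->
  exists s : rat, 0 <= s /\
   (K w (back t w (rat_mx R p.1) - ratr s *: back t w (rat_mx R p.2)) /\
    K w (ratr s *: back t w (rat_mx R p.2) - c *: back t w (rat_mx R p.1))).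

(** A counterexample to closeness persists in a neighbourhood, and by density and continuity this
    contains images of rational points of the cone. *)
Lemma rat_contractsP t w (c : R) : rat_contracts t w c -> contracts t w c.
Proof.
move=> H x y Kx x0 Ky y0; apply: contrapT => nQ.
have bc := @cocycle_continuous t (iter t Tinv w).
have := hilbert_close_notin_near (@Kclosed w) (phi_int w) (back_maps Ky) (back_neq0 Ky y0) nQ.
move=> [[U V] /= [cU [[V1 V2] /= [xV yV] VV]] UV].
move/subspace_continuousP: bc => bc.
have [q [Kq q0 Vq]] := rat_dense_cone (K_solid _) Kx x0 (bc _ Kx _ xV).
have [q' [Kq' q'0 Vq']] := rat_dense_cone (K_solid _) Ky y0 (bc _ Ky _ yV).
have [s [s0 Hs]] := H (q, q') (conj (conj Kq q0) (conj Kq' q'0)).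
have := UV (c, (back t w (rat_mx R q), back t w (rat_mx R q'))).
apply; first by split => /=; [exact: nbhs_singleton|apply: VV].
by exists (ratr s); rewrite // ler0q.
Qed.

(** Lowering the coefficient from [c] to [c'] opens an interval of admissible scales, from
    [s * c' / c] to [s], and a rational is taken there. *)
Lemma contracts_rat t w (c c' : R) : 0 <= c' < c -> contracts t w c -> rat_contracts t w c'.
Proof.
move=> /andP[c'0 c'c] H [p q] /= [[Kp p0] [Kq q0]].
have := back_maps Kp; have := back_neq0 Kp p0; have := back_maps Kq.
have [s s0 [K1 K2]] := H _ _ Kp p0 Kq q0.
move: K1 K2; set x := back _ _ _; set y := back _ _ _ => K1 K2 Ky x0 Kx.
have c0 : 0 < c by exact: le_lt_trans c'c.
have {}s0 : 0 < s.
  rewrite lt_neqAle s0 andbT eq_sym; apply/eqP => s00; apply: x0.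
  have /eqP : c *: x = 0.
    apply: (proper_cone_eq0 (@Kproper w)); first by apply: coneZ => //; exact: ltW.
    by move: K2; rewrite s00 scale0r sub0r.
  by rewrite scaler_eq0 gt_eqF//= => /eqP.
have [r] : exists r : rat, ratr r \in `]s * c' / c, s[.
  apply: rat_in_itvoo; rewrite ltr_pdivrMr// ltr_pM2l//.
rewrite in_itv/= => /andP[r1 r2].
have r0 : 0 <= ratr r :> R.
  by apply: le_trans (ltW r1); rewrite divr_ge0 ?mulr_ge0 ?(ltW s0) ?(ltW c0).
exists r; split; [by rewrite ler0q in r0|split].
  rewrite (_ : _ - _ = x - s *: y + (s - ratr r) *: y); last first.
    by rewrite scalerBl addrA subrK.
  by apply: coneD => //; apply: coneZ => //; rewrite subr_ge0 ltW.
rewrite (_ : _ - _ = (ratr r / s) *: (s *: y - c *: x) + (ratr r / s * c - c') *: x).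
  apply: coneD => //; apply: coneZ => //; first by rewrite divr_ge0// ltW.
  by rewrite subr_ge0 mulrAC ler_pdivlMr// mulrC -ler_pdivrMr// ltW.
by rewrite scalerBr !scalerA divfK ?gt_eqF// scalerBl addrA subrK.
Qed.

Lemma exceedsE (c : rat) w : 0 <= c ->
  exceeds c w <-> exists p : nat * rat, c < p.2 /\ rat_contracts p.1 w (ratr p.2).
Proof.
move=> c0; split => [[t [c' [cc' H]]]|[[t c'] /= [cc' H]]]; last first.
  by exists t, c'; split => //; exact: rat_contractsP.
(* Passing to rational scales costs a little of the coefficient; the midpoint still exceeds [c]. *)
exists (t, (c + c') / 2); split; first by rewrite /=; lra.
apply: contracts_rat H; rewrite /= ler0q ltr_rat; apply/andP; split; lra.
Qed.

(** * Normalized images and their limit point *)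

Definition normalize w (x : 'rV[R]_n) := (pairing (phi w) x)^-1 *: x.

Lemma cone_normalize w x : K w x -> x <> 0 ->
  K w (normalize w x) /\ pairing (phi w) (normalize w x) = 1.
Proof.
move=> Kx x0; have p0 := pairing_gt0 (phi_int w) Kx x0.
split; first by apply: coneZ => //; rewrite invr_ge0 ltW.
by rewrite pairingZ mulVf// gt_eqF.
Qed.

Lemma normalizeZ w (a : R) x : a != 0 -> normalize w (a *: x) = normalize w x.
Proof. by move=> a0; rewrite /normalize pairingZ scalerA invfM mulrAC mulVf// mul1r. Qed.

Lemma normalize_id w x : pairing (phi w) x = 1 -> normalize w x = x.
Proof. by rewrite /normalize => ->; rewrite invr1 scale1r. Qed.

(** Pairing with [phi w] forces [c <= s <= 1]. Then [x - y] splits into two terms, each of norm at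
    most [k * (1 - s)]. *)
Lemma hilbert_close_norm w : exists2 k : R, 0 < k & forall c x y, K w x -> K w y ->
  pairing (phi w) x = 1 -> pairing (phi w) y = 1 -> hilbert_close (K w) c x y ->
  `|x - y| <= k * (1 - c).
Proof.
have [k k0 Hk] := pairing_dual_interior (phi_int w).
exists (2 * k); first by rewrite mulr_gt0.
move=> c x y Kx Ky x1 y1 [s s0 [K1 K2]].
have := pairing_ge0 (phi_int w) K1; rewrite pairingB pairingZ x1 y1 mulr1 => s1.
have := pairing_ge0 (phi_int w) K2; rewrite pairingB !pairingZ x1 y1 !mulr1 => sc.
have -> : x - y = (x - s *: y) - (1 - s) *: y.
  by rewrite scalerBl scale1r opprB addrA subrK.
have := Hk _ K1; have := Hk _ Ky; rewrite pairingB pairingZ x1 y1 !mulr1 => h1 h2.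
apply: le_trans (ler_normB _ _) _; rewrite normrZ (ger0_norm s1).
have h3 : (1 - s) * `|y| <= (1 - s) * k by rewrite ler_wpM2l.
have h4 : k * (1 - s) <= k * (1 - c) by apply: ler_wpM2l; [exact: ltW|lra].
by rewrite (mulrC (1 - s)) in h3; rewrite -mulrA; lra.
Qed.

Definition attracting w z := [/\ interior (K w) z, pairing (phi w) z = 1 &
  forall e : R, 0 < e -> exists t0 : nat, forall t, (t0 <= t)%N ->
    forall x, K (iter t Tinv w) x -> x <> 0 -> `|normalize w (back t w x) - z| <= e].

Lemma attracting_cvg w z (y : nat -> 'rV[R]_n) : attracting w z ->
  (forall t, K (iter t Tinv w) (y t) /\ y t <> 0) ->
  normalize w (back t w (y t)) @[t --> \oo] --> z.
Proof.
move=> [_ _ Hz] Hy; apply/cvgrPdist_le => e e0.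
have [t0 H] := Hz _ e0; exists t0 => // t /= t0t.
by rewrite distrC; apply: H => //; have [] := Hy t.
Qed.

Lemma nonzero_points : exists u : Omega -> 'rV[R]_n, forall w, K w (u w) /\ u w <> 0.
Proof.
have [w|u Hu] := @choice _ _ (fun w u => K w u /\ u <> 0); last by exists u.
by have [x /interior_subset Kx x0] := cone_interior_neq0 w; exists x.
Qed.

(** The sets [I t] of normalized images are nested with diameters tending to 0, so any sequence of
    representatives is Cauchy and its limit attracts uniformly. *)
Lemma regular_attracting w : regular w -> exists z, attracting w z.
Proof.
move=> rw; have [k k0 Hk] := hilbert_close_norm w; have [u Hu] := nonzero_points.
pose I t := [set normalize w (back t w x) | x in [set x | K (iter t Tinv w) x /\ x <> 0]].
have IS t t' : (t <= t')%N -> I t' `<=` I t.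
  move=> /subnKC <- _ [x [Kx x0] <-]; move: Kx; rewrite addnC iterD => Kx.
  exists (back (t' - t) (iter t Tinv w) x); last by rewrite addnC backD.
  by split; [exact: back_maps|exact: back_neq0].
have IK t p : I t p -> K w p /\ pairing (phi w) p = 1.
  by move=> [x [Kx x0] <-]; apply: cone_normalize; [exact: back_maps|exact: back_neq0].
have IQ t c p q : contracts t w c -> I t p -> I t q -> hilbert_close (K w) c p q.
  move=> Hc [x [Kx x0] <-] [y [Ky y0] <-]; apply: hilbert_closeZ; [exact: Kcone|..].
  - by rewrite invr_gt0; apply: pairing_gt0 (phi_int w) (back_maps Kx) (back_neq0 Kx x0).
  - by rewrite invr_gt0; apply: pairing_gt0 (phi_int w) (back_maps Ky) (back_neq0 Ky y0).
  - exact: Hc.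
have small e : 0 < e -> exists t, forall p q, I t p -> I t q -> `|p - q| <= e.
  move=> e0; have c1 : 1 - e / k < 1 by rewrite ltrBlDr ltrDl divr_gt0.
  have [t Hc] := regular_contracts rw c1; exists t => p q Ip Iq.
  have [[Kp p1] [Kq q1]] := (IK _ _ Ip, IK _ _ Iq).
  apply: le_trans (Hk _ _ _ Kp Kq p1 q1 (IQ _ _ _ _ Hc Ip Iq)) _.
  by rewrite opprB addrC subrK mulrC divfK ?gt_eqF.
pose y t := normalize w (back t w (u (iter t Tinv w))).
have Iy t t' : (t <= t')%N -> I t (y t').
  by move=> tt'; apply: (IS _ _ tt'); exists (u (iter t' Tinv w)).
have /cvg_ex[/= z yz] : cvg (y t @[t --> \oo]).
  apply/cauchy_cvgP/cauchy_exP => e e0.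
  have [|t Ht] := small (e / 2); first by rewrite divr_gt0.
  exists (y t), t => // t' /= tt'; rewrite -ball_normE /=.
  apply: le_lt_trans (Ht _ _ (Iy _ _ (leqnn t)) (Iy _ _ tt')) _.
  by rewrite ltr_pdivrMr// ltr_pMr// ltr1n.
have near_z e : 0 < e -> exists t, forall p, I t p -> `|p - z| <= e.
  move=> e0; have [t Ht] := small _ e0; exists t => p Ip.
  apply/ler_addgt0Pr => r r0; have : \forall t \near \oo, `|z - y t| <= r.
    by move/cvgrPdist_le : yz; exact.
  move=> [t1 _ /(_ (maxn t t1))]; rewrite /= leq_maxr => /(_ isT) h1.
  rewrite -(subrK (y (maxn t t1)) p) -addrA; apply: le_trans (ler_normD _ _) _.
  by rewrite lerD 1?distrC//; apply: Ht => //; apply: Iy; exact: leq_maxl.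
exists z; split.
(* Interiority of [z]: with coefficient 1/2, every [p] in [I t] satisfies [p >= q / 2] for one
   interior [q], and this inequality passes to the limit. *)
- have c1 : 1 / 2 < 1 :> R by lra.
  have [t Hc] := regular_contracts rw c1.
  have [e Ke e0] := cone_interior_neq0 (iter t Tinv w).
  have Kwe := interior_subset Ke.
  pose q := normalize w (back t w e).
  have Iq : I t q by exists e.
  have Kq : interior (K w) q.
    have bKe : interior (K w) (back t w e) by have := cocycle_interior t Ke; rewrite iterTK.
    apply: interior_coneZ => //; rewrite invr_gt0.
    exact: pairing_gt0 (phi_int w) (back_maps Kwe) (back_neq0 Kwe e0).
  clearbody q; suff Kz : K w (z - (1 / 2) *: q).
    rewrite -(subrK ((1 / 2) *: q) z) addrC; apply: interior_coneD => //.
    by apply: interior_coneZ => //; lra.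
  have Kp p : I t p -> K w (p - (1 / 2) *: q).
    move=> Ip; have [s s0 [K1 K2]] := IQ _ _ _ _ Hc Ip Iq.
    have [[_ p1] [Kwq q1]] := (IK _ _ Ip, IK _ _ Iq).
    have := pairing_ge0 (phi_int w) K2; rewrite pairingB !pairingZ p1 q1 !mulr1 => s12.
    rewrite (_ : _ - _ = p - s *: q + (s - 1 / 2) *: q); last first.
      by rewrite scalerBl addrA subrK.
    by apply: coneD => //; apply: coneZ.
  apply: contrapT => /(closed_notin_near (@Kclosed w)) nK.
  have /yz : nbhs z [set v | ~ K w (v - (1 / 2) *: q)].
    by have := nbhs_subr ((1 / 2) *: q) nK; rewrite subrK.
  move=> [t1 _ /(_ (maxn t t1))]; rewrite /= leq_maxr => /(_ isT); apply.
  by apply: Kp; apply: Iy; exact: leq_maxl.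
- have h1 : pairing (phi w) (y t) @[t --> \oo] --> pairing (phi w) z.
    exact: (cvg_comp _ _ yz (@pairing_continuous _ _ (phi w) z)).
  have h2 : pairing (phi w) (y t) @[t --> \oo] --> (1 : R).
    rewrite (_ : (fun t => _) = fun=> 1); first exact: cvg_cst.
    by apply/funext => t; have [] := IK _ _ (Iy _ _ (leqnn t)).
  exact: (cvg_unique _ h1 h2).
- move=> e e0; have [t0 Ht] := near_z _ e0; exists t0 => t t0t x Kx x0.
  by apply: Ht; apply: (IS _ _ t0t); exists x.
Qed.

(** [D w] sends the backward images at [w] to those at [T w]; both normalized sequences converge,
    the first image by continuity of [D w] at the interior point [z]. *)
Lemma attracting_eq w z z' : attracting w z -> attracting (T w) z' ->
  normalize (T w) (D w z) = z'.
Proof.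
move=> Az Az'; have [u Hu] := nonzero_points.
have [Kz z1 _] := Az; have Kwz := interior_subset Kz.
have yz := attracting_cvg Az (fun t => Hu (iter t Tinv w)).
set y := (fun t => normalize w _) in yz.
have Dz : D w (y t) @[t --> \oo] --> D w z.
  exact: (cvg_comp _ _ yz (interior_continuous (@D_cont w) Kz)).
have z0 : z <> 0 by exact: interior_cone_neq0 Kz.
have Dz0 : D w z <> 0 by exact: (@cocycle_neq0 1 w).
have pz : pairing (phi (T w)) (D w z) != 0.
  by rewrite gt_eqF//; exact: pairing_gt0 (phi_int _) (D_maps Kwz) Dz0.
have h1 : normalize (T w) (D w (y t)) @[t --> \oo] --> normalize (T w) (D w z).
  apply: cvgZ => //; apply: cvgV => //.
  exact: (cvg_comp _ _ Dz (@pairing_continuous _ _ (phi (T w)) (D w z))).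
have h2 : normalize (T w) (D w (y t)) @[t --> \oo] --> z'.
  apply/cvgrPdist_le => e e0; have [_ _ /(_ _ e0)[t0 H]] := Az'.
  exists t0 => // t /= t0t; have [Ku u0] := Hu (iter t Tinv w).
  have -> : normalize (T w) (D w (y t)) =
      normalize (T w) (back t.+1 (T w) (u (iter t Tinv w))).
    have -> : y t = (pairing (phi w) (back t w (u (iter t Tinv w))))^-1 *:
      back t w (u (iter t Tinv w)) by [].
    rewrite (@back_iter 1 t) /= D_homog//.
    - rewrite normalizeZ// invr_eq0 gt_eqF//.
      exact: pairing_gt0 (phi_int w) (back_maps Ku) (back_neq0 Ku u0).
    - rewrite invr_gt0.
      exact: pairing_gt0 (phi_int w) (back_maps Ku) (back_neq0 Ku u0).
    - exact: back_maps.
  by rewrite distrC; apply: H; rewrite ?iterSr ?TK// ltnW// ltnS.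
exact: (cvg_unique _ h1 h2).
Qed.

Lemma attracting_unique w z x (a : nat -> R) (u : nat -> 'rV[R]_n) : attracting w z ->
  (forall t, K (iter t Tinv w) (u t) /\ u t <> 0) ->
  pairing (phi w) x = 1 -> (forall t, a t != 0 /\ back t w (u t) = a t *: x) -> x = z.
Proof.
move=> Az Hu x1 Hx; have h1 := attracting_cvg Az Hu.
have h2 : normalize w (back t w (u t)) @[t --> \oo] --> x.
  rewrite (_ : (fun t => _) = fun=> x); first exact: cvg_cst.
  by apply/funext => t; have [a0 ->] := Hx t; rewrite normalizeZ// normalize_id.
exact: (cvg_unique _ h2 h1).
Qed.

(** The relation is iterated along the past of [w], so that an invariant section is a multiple of
    its own backward images. *)
Lemma back_invariant (alpha : Omega -> R) (x : Omega -> 'rV[R]_n) w :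
  (forall w, [/\ 0 <= alpha w, K w (x w) & pairing (phi w) (x w) = 1]) ->
  (forall t, alpha (iter t.+1 Tinv w) *: x (iter t Tinv w) =
     D (iter t.+1 Tinv w) (x (iter t.+1 Tinv w))) ->
  forall t, exists a : R, 0 < a /\ back t w (x (iter t Tinv w)) = a *: x w.
Proof.
move=> H E t; elim: t w E => [|t IH] w E.
  by exists 1; rewrite ltr01 scale1r.
have [|a [a0 Ha]] := IH (Tinv w).
  by move=> s; rewrite -!iterSr; exact: E s.+1.
have [al0 Kx x1] := H (Tinv w).
have x0 : x (Tinv w) <> 0 by move=> x0; move: x1; rewrite x0 pairing0 => /esym/eqP; rewrite oner_eq0.
exists (a * alpha (Tinv w)); rewrite iterSr backS Ha D_homog// -(E 0%N) scalerA; split => //.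
(* Only [0 <= alpha] is assumed; a zero value would make [D] send a nonzero cone vector to 0. *)
rewrite mulr_gt0// lt_neqAle al0 andbT eq_sym; apply/eqP => al00.
by apply: (@cocycle_neq0 1 _ _ Kx x0); rewrite /= -(E 0%N) /= al00 scale0r.
Qed.

End Dynamics.

(** * Random cones *)

Section AlmostEverywhere.
Context (R : realType) (d : measure_display) (Omega : measurableType d)
  (P : probability Omega R).

Lemma ae_forall (I : countType) (Q : I -> Omega -> Prop) :
  (forall i, {ae P, forall w, Q i w}) -> {ae P, forall w, forall i, Q i w}.
Proof.
move=> HQ; pose N k := if unpickle k is Some i then ~` [set w | Q i w] else set0 : set Omega.
have NN k : P.-negligible (N k).
  by rewrite /N; case: unpickle => [i|]; [exact: HQ|exact: negligible_set0].
apply: negligibleS (negligible_bigcup NN) => w /= /existsNP[i nQ].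
by exists (pickle i) => //; rewrite /N pickleK.
Qed.

Lemma ae_preserves (f : Omega -> Omega) (Q : Omega -> Prop) :
  preserves_measure P f -> {ae P, forall w, Q w} -> {ae P, forall w, Q (f w)}.
Proof.
move=> [mf Pf] [N [mN N0 QN]]; exists (f @^-1` N); split.
- by rewrite -[X in measurable X]setTI; exact: mf.
- by rewrite -N0; exact: Pf.
- by move=> w /= nQ; exact: QN.
Qed.

Lemma ae_iter (f : Omega -> Omega) (Q : Omega -> Prop) :
  preserves_measure P f -> {ae P, forall w, Q w} ->
  {ae P, forall w, forall t, Q (iter t f w)}.
Proof.
move=> Pf HQ; apply: ae_forall => t; elim: t => [//|t IH].
by have := ae_preserves Pf IH; apply: filterS => w; rewrite -iterSr.
Qed.

(* [A] and its preimage have the same measure, so the inclusion is an equality up to a null set. *)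
Lemma ae_preimage_subset (f : Omega -> Omega) (A : set Omega) :
  preserves_measure P f -> measurable A -> A `<=` f @^-1` A ->
  {ae P, forall w, A (f w) -> A w}.
Proof.
move=> [mf Pf] mA Af; exists (f @^-1` A `\` A).
have mfA : measurable (f @^-1` A) by rewrite -[X in measurable X]setTI; exact: mf.
split; first exact: measurableD.
  rewrite measureD//; last by rewrite ltey_eq fin_num_measure.
  rewrite setIidr//; transitivity (P A - P A)%E; first by congr (_ - _)%E; exact: Pf.
  by rewrite subee// fin_num_measure.
by move=> w /= /not_implyP.
Qed.

(** By completeness every subset of [N] is measurable and null, hence belongs to [G]. *)
Lemma borel_measurable_null (G : set (set Omega)) (N : set Omega) (Y : topologicalType)
    (f g : Omega -> Y) : sigma_algebra setT G -> measure_is_complete P ->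
  (forall A, measurable A -> P A = 0%E -> G A) -> measurable N -> P N = 0%E ->
  (forall w, ~ N w -> f w = g w) -> borel_measurable G g -> borel_measurable G f.
Proof.
move=> sG Pc nullG mN N0 fg mg B bB.
have GS A : A `<=` N -> G A.
  move=> AN; have neg : P.-negligible A by exists N.
  by apply: nullG; [exact: Pc|apply: measure_negligible => //; exact: Pc].
rewrite (_ : _ @^-1` _ = (~` N `&` g @^-1` B) `|` (N `&` f @^-1` B)).
  apply: sigma_setU => //; last by apply: GS => w [].
  by apply: sigma_setI => //; [apply: sigma_setC => //; exact: GS|exact: mg].
apply/seteqP; split => w /=; last by case=> -[Nw] //; rewrite fg.
by have [Nw|Nw] := pselect (N w) => Bw; [right|left; rewrite -fg].
Qed.

End AlmostEverywhere.

(** Taking the least admissible index makes a countable choice measurable. *)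
Lemma measurable_first_index (Omega : Type) (G : set (set Omega)) (A : nat -> set Omega) :
  sigma_algebra setT G -> (forall k, G (A k)) -> (forall w, exists k, A k w) ->
  exists h : Omega -> nat, (forall w, A (h w) w) /\ forall k, G [set w | h w = k].
Proof.
move=> sG GA exA.
have exb w : exists k, `[< A k w >] by have [k Ak] := exA w; exists k; exact/asboolP.
exists (fun w => ex_minn (exb w)); split.
  by move=> w; case: ex_minnP => m /asboolP.
move=> k; rewrite (_ : mkset _ = A k `&` [set w | forall j, ((j < k)%N -> ~ A j w)]).
  apply: sigma_setI => //; apply: sigma_forall => // j.
  rewrite (_ : (fun w => _) = [set w | ~ (j < k)%N] `|` ~` A j).
    by apply: sigma_setU => //; [exact: sigma_cst|exact: sigma_setC].
  apply/seteqP; split => w /= H; last by case: H.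
  by have [jk|jk] := pselect (j < k)%N; [right; exact: H|left].
apply/seteqP; split => w /=.
  case: ex_minnP => m /asboolP Am mmin <-; split => // j jm Aj.
  by have := mmin j; rewrite leqNgt jm; move/asboolP: Aj => -> /(_ isT).
move=> [Ak Hk]; case: ex_minnP => m /asboolP Am mmin.
apply/eqP; rewrite eqn_leq; apply/andP; split; first by apply: mmin; exact/asboolP.
by rewrite leqNgt; apply/negP => /Hk.
Qed.

(** * Measurability of the coefficients and of the attracting point *)

Section RandomCones.
Context (R : realType) (n : nat) (n_gt0 : (0 < n)%N)
    (d : measure_display) (Omega : measurableType d) (P : probability Omega R)
    (P_complete : measure_is_complete P)
    (T Tinv : Omega -> Omega) (T_aut : automorphism P T Tinv)
    (F : int -> set (set Omega)) (F_filt : invariant_filtration P T F)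
    (K : Omega -> set 'rV[R]_n)
    (K_meas : graph_measurable (F 0) K)
    (K_solid : forall w, solid_cone (K w))
    (D : Omega -> 'rV[R]_n -> 'rV[R]_n)
    (D_maps : forall w x, K w x -> K (T w) (D w x))
    (phi : Omega -> 'cV[R]_n)
    (phi_meas : borel_measurable (F 0) phi)
    (phi_int : forall w, interior (dual_cone (K w)) (phi w))
    (D_cont : forall w, {within K w, continuous (D w)})
    (D_meas : borel_measurable
       (prod_sigma_algebra (F 1) (borel_sets 'rV[R]_n)) (extension K D))
    (D_homog : forall w (lambda : R) x, 0 < lambda -> K w x ->
       D w (lambda *: x) = lambda *: D w x)
    (D_mono : forall w, completely_monotone (K w) (K (T w)) (D w))
    (C_strict : {ae P, forall w, exists l : nat,
       strictly_monotone (K w) (K (iter l T w)) (cocycle T D l w)}).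

Let TK : cancel T Tinv. Proof. by case: T_aut. Qed.
Let TinvK : cancel Tinv T. Proof. by case: T_aut. Qed.
Let sF t : sigma_algebra setT (F t). Proof. by case: F_filt => /(_ t)[]. Qed.
Let Fmeas t A : F t A -> measurable A. Proof. by case: F_filt => /(_ t)[_ H] _ _ _ /H. Qed.
Let F_sub A : F 0 A -> F 1 A. Proof. by case: F_filt => _ /(_ 0) + _ _; rewrite add0r; exact. Qed.

Let F_Tinv A : F 1 A -> F 0 (Tinv @^-1` A).
Proof.
case: F_filt => _ _ _ /(_ 0); rewrite add0r => -> [B FB <-].
by rewrite (_ : _ @^-1` _ = B)//; apply/seteqP; split => w /=; rewrite TinvK => //; case.
Qed.

Lemma cone_section_measurable (z : Omega -> 'rV[R]_n) :
  borel_measurable (F 0) z -> F 0 [set w | K w (z w)].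
Proof. by move=> mz; exact: (section_measurable (sF 0) mz K_meas). Qed.

Lemma image_measurable (y : Omega -> 'rV[R]_n) :
  borel_measurable (F 0) y -> (forall w, K w (y w)) ->
  borel_measurable (F 1) (fun w => D w (y w)).
Proof.
move=> my Ky; apply: borel_measurable_open => // U Uo.
have oU : @open (one_point_compactification 'rV[R]_n) (Some @` U).
  exact: one_point_compactification_open_some.
have my1 B : borel_sets 'rV[R]_n B -> F 1 (y @^-1` B) by move=> /my/F_sub.
have bU : borel_sets _ (Some @` U : set (one_point_compactification 'rV[R]_n)).
  by apply: sub_sigma_algebra.
have := section_measurable (sF 1) my1 (D_meas bU).
congr (F 1 _); apply/seteqP; split => w /=; rewrite /extension/=; case: ifPn.
- by move=> _ [v Uv [<-]].
- by move=> _ [].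
- by move=> _ Uw; exists (D w (y w)).
- by rewrite notin_setE => /(_ (Ky w)).
Qed.

(** Transports sections of [K] forward. Measurability over [F 0] is kept because [D] raises it to
    [F 1] and composition with [Tinv] brings it back. *)
Definition push (y : Omega -> 'rV[R]_n) w := D (Tinv w) (y (Tinv w)).

Lemma push_measurable y : borel_measurable (F 0) y -> (forall w, K w (y w)) ->
  borel_measurable (F 0) (push y) /\ forall w, K w (push y w).
Proof.
move=> my Ky; split.
  by move=> B /(image_measurable my Ky)/F_Tinv.
by move=> w; rewrite -{1}(TinvK w); exact: D_maps.
Qed.

Lemma iter_push t y w : iter t push y w = back T Tinv D t w (y (iter t Tinv w)).
Proof. by elim: t w => //= t IH w; rewrite backS// /push IH -iterSr. Qed.

Lemma iter_push_measurable t y : borel_measurable (F 0) y -> (forall w, K w (y w)) ->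
  borel_measurable (F 0) (iter t push y) /\ forall w, K w (iter t push y w).
Proof. by move=> my Ky; elim: t => //= t [H1 H2]; exact: push_measurable. Qed.

Lemma subZ_measurable (y z : Omega -> 'rV[R]_n) (a b : R) :
  borel_measurable (F 0) y -> borel_measurable (F 0) z ->
  borel_measurable (F 0) (fun w => a *: y w - b *: z w).
Proof.
move=> my mz.
apply: (@borel_measurable_comp _ _ (sF 0) _ _ (fun w => (y w, z w))
  (fun p : 'rV[R]_n * 'rV[R]_n => a *: p.1 - b *: p.2)).
  move=> w; apply: cvgB; apply: cvgZl_tmp; [exact: cvg_fst|exact: cvg_snd].
exact: borel_measurable_pair.
Qed.

Lemma exceeds_measurable (c : rat) : 0 <= c -> F 0 [set w | exceeds T Tinv K D c w].
Proof.
move=> c0.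
rewrite (_ : mkset _ = [set w | exists p : nat * rat, c < p.2 /\
    rat_contracts T Tinv K D p.1 w (ratr p.2)]); last first.
  have E w : exceeds T Tinv K D c w <-> exists p : nat * rat, c < p.2 /\
    rat_contracts T Tinv K D p.1 w (ratr p.2) by exact: exceedsE.
  by apply/seteqP; split => w; apply E.
apply: sigma_exists => // -[t c'] /=; apply: sigma_setI => //; first exact: sigma_cst.
apply: sigma_forall => // -[p q] /=.
have K0 w : K w 0.
  by have [[cK _] _ [x /interior_subset Kx]] := K_solid w; exact: cone0 Kx.
have Kr (r : 'rV[rat]_n) : F 0 [set w | K w (rat_mx R r)].
  by apply: cone_section_measurable; exact: borel_measurable_cst.
have KTr (r : 'rV[rat]_n) : F 0 [set w | K (iter t Tinv w) (rat_mx R r)].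
  elim: t => //= t IH; have := F_Tinv (F_sub IH); congr (F 0 _).
  by apply/funext => w /=; rewrite -iterSr.
(* A constant rational vector need not lie in every cone; replacing it by 0 outside gives a genuine
   section that can be pushed. *)
pose s (r : 'rV[rat]_n) w : 'rV[R]_n := if `[< K w (rat_mx R r) >] then rat_mx R r else 0.
have ms r : borel_measurable (F 0) (s r).
  apply: borel_measurable_if => //; [|exact: borel_measurable_cst..].
  by rewrite (_ : mkset _ = [set w | K w (rat_mx R r)])//; apply/seteqP; split => w /asboolP.
have Ks r w : K w (s r w) by rewrite /s; case: ifPn => [/asboolP|].
have my r := (iter_push_measurable t (ms r) (Ks r)).1.
(* The implication becomes a union. When its premise holds, the truncated sections agree with the
   rational vectors at the starting point. *)
rewrite (_ : (fun w => _) = ~` [set w | (K (iter t Tinv w) (rat_mx R p) /\ rat_mx R p <> 0) /\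
   (K (iter t Tinv w) (rat_mx R q) /\ rat_mx R q <> 0)] `|`
  [set w | exists r : rat, 0 <= r /\
   (K w (1 *: iter t push (s p) w - ratr r *: iter t push (s q) w) /\
    K w (ratr r *: iter t push (s q) w - ratr c' *: iter t push (s p) w))]); last first.
  have E w (r : 'rV[rat]_n) : K (iter t Tinv w) (rat_mx R r) ->
      iter t push (s r) w = back T Tinv D t w (rat_mx R r).
    by move=> Kr'; rewrite iter_push /s asboolT.
  apply/seteqP; split => w /=.
    move=> H; have [h|h] := pselect ((K (iter t Tinv w) (rat_mx R p) /\ rat_mx R p <> 0) /\
      (K (iter t Tinv w) (rat_mx R q) /\ rat_mx R q <> 0)); [right|by left].
    have [r [r0 [h1 h2]]] := H h; exists r; case: h => -[kp _] [kq _].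
    by rewrite scale1r !E.
  move=> [//|[r [r0 [h1 h2]]]] [[kp _] [kq _]]; exists r.
  by move: h1 h2; rewrite scale1r !E.
apply: sigma_setU => //.
  apply: sigma_setC => //; apply: sigma_setI => //.
    exact: (sigma_setI (sF 0) (KTr p) (sigma_cst (sF 0) _)).
  exact: (sigma_setI (sF 0) (KTr q) (sigma_cst (sF 0) _)).
apply: sigma_exists => // r; apply: sigma_setI => //; first exact: sigma_cst.
by apply: sigma_setI => //; apply: cone_section_measurable; exact: subZ_measurable.
Qed.

(** The set where [c] is exceeded is contained in its preimage under [T], so the two agree up to a
    null set. Countably many [c] and iterates are then combined. *)
Lemma ae_regular : {ae P, forall w, regular T Tinv K D w}.
Proof.
have [_ _ PT _] := T_aut.
have h1 : {ae P, forall w, forall c : rat, 0 <= c ->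
    exceeds T Tinv K D c (T w) -> exceeds T Tinv K D c w}.
  apply: ae_forall => c; have [c0|c0] := leP 0 c; last first.
    by apply: aeW => w.
  have := ae_preimage_subset PT (Fmeas (exceeds_measurable c0)) _.
  have sub : [set w | exceeds T Tinv K D c w] `<=` T @^-1` [set w | exceeds T Tinv K D c w].
    by move=> w /=; exact: exceeds_shift.
  by move=> /(_ sub); apply: filterS => w /= H _.
have := ae_iter PT h1; have := ae_iter PT C_strict.
by apply: filterS2 => w H1 H2 t; split; [exact: H2|exact: H1].
Qed.

Lemma nonzero_selection : exists2 a : Omega -> 'rV[R]_n,
  borel_measurable (F 0) a & forall w, K w (a w) /\ a w <> 0.
Proof.
pose q k : 'rV[R]_n := if unpickle k is Some r then rat_mx R (r : 'rV[rat]_n) else 0.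
have [|w|h [Ah mh]] := @measurable_first_index _ (F 0)
    (fun k => [set w | K w (q k) /\ q k <> 0]) (sF 0).
- move=> k; apply: sigma_setI => //; last exact: sigma_cst.
  by apply: cone_section_measurable; exact: borel_measurable_cst.
- have [x /interior_subset Kx x0] := cone_interior_neq0 n_gt0 K_solid w.
  have [r [Kr r0 _]] := rat_dense_cone (K_solid w) Kx x0 filterT.
  by exists (pickle r); rewrite /= /q pickleK.
- exists (q \o h); last exact: Ah.
  move=> B bB; rewrite (_ : _ @^-1` _ = [set w | exists k, h w = k /\ B (q k)]).
    by apply: sigma_exists => // k; exact: (sigma_setI (sF 0) (mh k) (sigma_cst (sF 0) _)).
  apply/seteqP; split => w /=; first by exists (h w).
  by move=> [k [-> ]].
Qed.

Lemma pairing_measurable G (f : Omega -> 'cV[R]_n) (y : Omega -> 'rV[R]_n) :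
  sigma_algebra setT G -> borel_measurable G f -> borel_measurable G y ->
  borel_measurable G (fun w => pairing (f w) (y w)).
Proof.
move=> sG mf my.
apply: (@borel_measurable_comp _ _ sG _ _ (fun w => (f w, y w))
  (fun p : 'cV[R]_n * 'rV[R]_n => pairing p.1 p.2)); last exact: borel_measurable_pair.
by move=> w; apply: cvg_pairing; [exact: cvg_fst|exact: cvg_snd].
Qed.

(** Normalization is continuous at the values concerned, since the pairing is positive on nonzero
    vectors of the cone. *)
Lemma normalize_measurable (y : Omega -> 'rV[R]_n) : borel_measurable (F 0) y ->
  (forall w, K w (y w) /\ y w <> 0) -> borel_measurable (F 0) (fun w => normalize phi w (y w)).
Proof.
move=> my Hy.
apply: (@borel_measurable_comp _ _ (sF 0) _ _ (fun w => (phi w, y w))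
  (fun p : 'cV[R]_n * 'rV[R]_n => (pairing p.1 p.2)^-1 *: p.2)); last exact: borel_measurable_pair.
move=> w; apply: cvgZ; last exact: cvg_snd.
apply: cvgV => /=; last by apply: cvg_pairing; [exact: cvg_fst|exact: cvg_snd].
by rewrite gt_eqF//; apply: pairing_gt0 (phi_int w) _ _; have [] := Hy w.
Qed.

(* On the exceptional null set the value is arbitrary, which is harmless because
   F_0 contains every null set. *)
Lemma random_attractor : exists2 x : Omega -> 'rV[R]_n, borel_measurable (F 0) x &
  (forall w, interior (K w) (x w) /\ pairing (phi w) (x w) = 1) /\
  {ae P, forall w, attracting T Tinv K D phi w (x w)}.
Proof.
have [N [mN N0 regN]] := ae_regular.
have [w|x Hx] := @choice _ _ (fun w z => [/\ interior (K w) z, pairing (phi w) z = 1 &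
    ~ N w -> attracting T Tinv K D phi w z]).
  have [Nw|Nw] := pselect (N w); last first.
    have rw : regular T Tinv K D w by apply: contrapT => nr; apply: Nw; exact: regN.
    have [z Az] : exists z, attracting T Tinv K D phi w z by exact: regular_attracting.
    by exists z; have [] := Az.
  have [z Kz z0] := cone_interior_neq0 n_gt0 K_solid w.
  have p0 := pairing_gt0 (phi_int w) (interior_subset Kz) z0.
  exists (normalize phi w z); split => //.
    by apply: interior_coneZ; [have [[]] := K_solid w|rewrite invr_gt0|].
  by rewrite pairingZ mulVf// gt_eqF.
have [a ma Ha] := nonzero_selection.
have Ka w : K w (a w) by have [] := Ha w.
have back0 t w : iter t push a w <> 0.
  rewrite iter_push; apply: (@cocycle_neq0 _ _ _ T K) => //; by have [] := Ha (iter t Tinv w).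
(* On the null set [N] the sequence is set to its intended limit, so that convergence holds
   everywhere. *)
pose f t w := if `[< N w >] then x w else normalize phi w (iter t push a w).
exists x; last first.
  split; first by move=> w; have [] := Hx w.
  by exists N; split => // w /= nA; apply: contrapT => Nw; apply: nA; have [_ _] := Hx w; exact.
apply: (@borel_measurable_cvg _ _ (sF 0) _ _ _ f).
  move=> t; apply: (@borel_measurable_null _ _ _ P (F 0) N _ _
      (fun w => normalize phi w (iter t push a w))) => //.
  - by case: F_filt => _ _ + _; exact.
  - by move=> w Nw; rewrite /f asboolF.
  - have [m1 m2] := iter_push_measurable t ma Ka.
    by apply: normalize_measurable.
move=> w; have [Nw|Nw] := pselect (N w).
  by rewrite /f asboolT//; exact: cvg_cst.
rewrite /f asboolF//; have [_ _ /(_ Nw) Az] := Hx w.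
have := attracting_cvg Az (fun t => Ha (iter t Tinv w)).
by under [in X in _ -> X]eq_fun do rewrite iter_push.
Qed.

End RandomCones.

(** * Existence, uniqueness and uniform convergence *)

Theorem theorem1 (R : realType) (n : nat) (n_gt0 : (0 < n)%N)
    (N : 'rV[R]_n -> R) (N_norm : is_norm N)
    (d : measure_display) (Omega : measurableType d) (P : probability Omega R)
    (P_complete : measure_is_complete P)
    (T Tinv : Omega -> Omega) (T_aut : automorphism P T Tinv)
    (F : int -> set (set Omega)) (F_filt : invariant_filtration P T F)
    (K : Omega -> set 'rV[R]_n)
    (K_meas : graph_measurable (F 0) K)
    (K_solid : forall w, solid_cone (K w))
    (D : Omega -> 'rV[R]_n -> 'rV[R]_n)
    (D_maps : forall w x, K w x -> K (T w) (D w x))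
    (phi : Omega -> 'cV[R]_n)
    (phi_meas : borel_measurable (F 0) phi)
    (phi_int : forall w, interior (dual_cone (K w)) (phi w))
    (D_cont : forall w, {within K w, continuous (D w)})
    (D_meas : borel_measurable
       (prod_sigma_algebra (F 1) (borel_sets 'rV[R]_n)) (extension K D))
    (D_homog : forall w (lambda : R) x, 0 < lambda -> K w x ->
       D w (lambda *: x) = lambda *: D w x)
    (D_mono : forall w, completely_monotone (K w) (K (T w)) (D w))
    (C_strict : {ae P, forall w, exists l : nat,
       strictly_monotone (K w) (K (iter l T w)) (cocycle T D l w)}) :
  exists (x : Omega -> 'rV[R]_n) (alpha : Omega -> R),
    [/\ [/\ borel_measurable (F 0) x,
            borel_measurable (F 1) alpha,
            forall w, [/\ 0 < alpha w, interior (K w) (x w)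
                        & pairing (phi w) (x w) = 1]
          & {ae P, forall w, alpha w *: x (T w) = D w (x w)}],
        forall (x1 x2 : Omega -> 'rV[R]_n) (alpha1 alpha2 : Omega -> R),
          (forall w, [/\ 0 <= alpha1 w, K w (x1 w) & pairing (phi w) (x1 w) = 1]) ->
          {ae P, forall w, alpha1 w *: x1 (T w) = D w (x1 w)} ->
          (forall w, [/\ 0 <= alpha2 w, K w (x2 w) & pairing (phi w) (x2 w) = 1]) ->
          {ae P, forall w, alpha2 w *: x2 (T w) = D w (x2 w)} ->
          {ae P, forall w, alpha1 w = alpha2 w /\ x1 w = x2 w}
      & {ae P, forall w,
          (fun t : nat =>
             ereal_sup [set (N ((pairing (phi w) (cocycle T D t (iter t Tinv w) a))^-1
                                  *: cocycle T D t (iter t Tinv w) a - x w))%:E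
                       | a in [set a | K (iter t Tinv w) a /\ a <> 0]])
          @ \oo --> (0 : \bar R)%E}].
Proof.
have [TK TinvK PT PTinv] := T_aut.
have [x mx [Hx attx]] := random_attractor n_gt0 P_complete T_aut F_filt K_meas K_solid D_maps
  phi_meas phi_int D_cont D_meas D_homog D_mono C_strict.
have Kx w : K w (x w) by have [/interior_subset] := Hx w.
have neq0 w z : pairing (phi w) z = 1 -> z <> 0.
  by move=> + z0; rewrite z0 pairing0 => /esym/eqP; rewrite oner_eq0.
have Dneq0 w z : K w z -> z <> 0 -> D w z <> 0.
  exact: (@cocycle_neq0 _ _ _ T K K_solid D D_maps D_homog D_mono 1 w z).
(* The normalization of [D w (x w)] is [x (T w)], so the pairing used to normalize is the factor
   [alpha w]. *)
have rel : {ae P, forall w, pairing (phi (T w)) (D w (x w)) *: x (T w) = D w (x w)}.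
  have := ae_preserves PT attx; have := attx; apply: filterS2 => w Aw ATw.
  have <- : normalize phi (T w) (D w (x w)) = x (T w) by exact: attracting_eq Aw ATw.
  rewrite scalerA mulfV ?scale1r// gt_eqF//.
  by apply: pairing_gt0 (phi_int _) _ _; [exact: D_maps|apply: Dneq0 => //; apply: neq0; exact: (Hx w).2].
(* Almost surely the relation holds along the whole past of [w]; then [x1 w] equals all its
   normalized backward images and hence their limit [x w]. *)
have uniq (x1 : Omega -> 'rV[R]_n) (alpha1 : Omega -> R) :
    (forall w, [/\ 0 <= alpha1 w, K w (x1 w) & pairing (phi w) (x1 w) = 1]) ->
    {ae P, forall w, alpha1 w *: x1 (T w) = D w (x1 w)} ->
    {ae P, forall w, x1 w = x w}.
  move=> H1 E1; have := ae_iter PTinv (ae_preserves PTinv E1); have := attx.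
  apply: filterS2 => w Aw Ew.
  have back1 t : exists a : R, 0 < a /\ back T Tinv D t w (x1 (iter t Tinv w)) = a *: x1 w.
    apply: (back_invariant TinvK K_solid D_maps D_homog D_mono H1) => s.
    by have := Ew s; rewrite TinvK.
  have [a Ha] := choice back1.
  apply: (@attracting_unique _ _ _ T Tinv K D phi w (x w) (x1 w) a (fun t => x1 (iter t Tinv w)) Aw) => //.
  - move=> t; have [_ K1 p1] := H1 (iter t Tinv w); split => //; exact: neq0 p1.
  - by have [] := H1 w.
  - by move=> t; have [a0 ->] := Ha t; rewrite gt_eqF.
have alphaE (x1 : Omega -> 'rV[R]_n) (alpha1 : Omega -> R) w :
    (forall w, [/\ 0 <= alpha1 w, K w (x1 w) & pairing (phi w) (x1 w) = 1]) ->
    alpha1 w *: x1 (T w) = D w (x1 w) -> alpha1 w = pairing (phi (T w)) (D w (x1 w)).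
  by move=> H1 <-; have [_ _ p1] := H1 (T w); rewrite pairingZ p1 mulr1.
exists x, (fun w => pairing (phi (T w)) (D w (x w))); split.
- split => //.
  + have [sF _ _ FT] := F_filt.
    have F1E := FT 0; rewrite add0r in F1E.
    apply: pairing_measurable; first by have [] := sF 1.
    * by move=> B /phi_meas FB; rewrite F1E; exists (phi @^-1` B) => //; rewrite setTI.
    * by apply: (image_measurable F_filt D_meas).
  + move=> w; have [Kow p1] := Hx w; split => //.
    apply: pairing_gt0 (phi_int _) _ _; first exact: D_maps.
    by apply: Dneq0 => //; exact: neq0 p1.
- move=> x1 x2 alpha1 alpha2 H1 E1 H2 E2.
  have U1 := uniq _ _ H1 E1; have U2 := uniq _ _ H2 E2.
  near=> w.
  have e1 : x1 w = x w by near: w.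
  have e2 : x2 w = x w by near: w.
  rewrite (alphaE _ _ _ H1); last by near: w.
  rewrite (alphaE _ _ _ H2); last by near: w.
  by rewrite e1 e2.
- have [M M0 NM] := norm_bound N_norm.
  have := attx; apply: filterS => w [_ _ Aw] A /= A0.
  have [e /= e0 He] : exists2 e : R, 0 < e & forall r : R, `|r| < e -> A r%:E.
    have : nbhs (0 : R) (fun r => A r%:E) by exact: A0.
    by move=> /nbhs_ballP[e /= e0 He]; exists e => // r re; apply: He; rewrite /ball/= sub0r normrN.
  (* The [M + 1] avoids division by zero; [e / 2] leaves a strict margin, as a supremum only gives a
     weak bound. *)
  have d0 : 0 < e / 2 / (M + 1) by rewrite !divr_gt0// ltr_wpDl.
  have [t0 Ht0] := Aw _ d0; exists t0 => // t /= t0t.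
  set S := [set _ | a in _].
  have Sle : (ereal_sup S <= (e / 2)%:E)%E.
    apply: ge_ereal_sup => _ [a [Ka a0] <-]; rewrite lee_fin.
    apply: le_trans (NM _) _; have := Ht0 _ t0t _ Ka a0; rewrite /normalize /back => h.
    apply: le_trans (ler_wpM2l M0 h) _.
    by rewrite mulrCA ler_piMr ?divr_ge0 ?(ltW e0)// ler_pdivrMr ?mul1r ?lerDl// ltr_wpDl.
  (* A nonzero cone vector makes the set nonempty, so its supremum is not minus infinity. *)
  have Sge : (0%:E <= ereal_sup S)%E.
    have [a Ka a0] := cone_interior_neq0 n_gt0 K_solid (iter t Tinv w).
    have Kca := interior_subset Ka.
    apply: le_trans (ereal_sup_ubound _); last by exists a; [split; [exact: Kca|exact: a0]|reflexivity].
    by rewrite lee_fin norm_ge0.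
  have Sfin : ereal_sup S \is a fin_num.
    by rewrite fin_numE; apply/andP; split; [apply: contraTneq Sge => ->|apply: contraTneq Sle => ->].
  change (A (ereal_sup S)); rewrite -(fineK Sfin); apply: He.
  move: Sle Sge; rewrite -(fineK Sfin) !lee_fin => S1 S2.
  by rewrite ger0_norm//=; apply: le_lt_trans S1 _; rewrite ltr_pdivrMr// ltr_pMr// ltr1n.
Unshelve. all: by end_near. Qed.
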